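(* Let $K$ be a field containing $\mathbb{Q}_p$, complete with respect to a non-Archimedean absolute value $|\cdot|$ with $|p|=1/p$, let $\mathfrak{o}$ be its valuation ring, and let $R$ be a subring of $\mathfrak{o}$ (with the topology induced by $|\cdot|$). If $\mathcal{M}$ is a finitely generated $K\langle x_1,\ldots,x_d,z\rangle$-module, then the set of $c\in R$ for which $\mathcal{M}|_{z=c}=(0)$ is open in $R$. If $R$ is compact, then there exists $\varepsilon>0$ such that, up to the addition and removal of finite sets, the set of $c\in R$ for which $\mathcal{M}|_{z=c}=(0)$ is a union of balls in $R$ of radius $\varepsilon$. In particular, if $R=\mathbb{Z}$, then up to addition and removal of finite sets, the set of $c\in\mathbb{Z}$ for which $\mathcal{M}|_{z=c}=(0)$ is a finite union of arithmetic progressions with difference $p^r$ for some $r\ge0$.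
   Context: $K\langle x_1,\ldots,x_d,z\rangle$ is the Tate algebra of power series over $K$ whose coefficients tend to $0$. For $c\in\mathfrak{o}$, $\mathcal{M}|_{z=c}$ denotes $\mathcal{M}/(z-c)\mathcal{M}$. *)

(* Defs.v *)
From Stdlib Require Import Reals.
From HB Require Import structures.
From mathcomp Require Import all_boot all_order all_algebra.
Set Implicit Arguments. Unset Strict Implicit. Unset Printing Implicit Defensive.
Import Order.TTheory GRing.Theory Num.Theory.
Local Open Scope ring_scope.

(* A field K with a non-Archimedean absolute value |.| : K -> R, |p| = 1/p,
   complete w.r.t. |.|.  (Such a K automatically has characteristic 0 and
   contains the closure Q_p of Q.) *)
Record NAField (p : nat) (K : fieldType) := {
  nabs : K -> R;
  nabs_ge0 : forall x, Rle R0 (nabs x);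
  nabs_eq0 : forall x, nabs x = R0 <-> x = 0;
  nabs_mul : forall x y, nabs (x * y) = Rmult (nabs x) (nabs y);
  nabs_ultra : forall x y, Rle (nabs (x + y)) (Rmax (nabs x) (nabs y));
  nabs_p : nabs (p%:R) = Rinv (INR p);
  nabs_complete : forall u : nat -> K,
    (forall eps, Rlt R0 eps -> exists N, forall m n, (N <= m)%N -> (N <= n)%N ->
        Rlt (nabs (u m - u n)) eps) ->
    exists l, forall eps, Rlt R0 eps -> exists N, forall n, (N <= n)%N ->
        Rlt (nabs (u n - l)) eps
}.

Definition mi (n : nat) := {ffun 'I_n -> nat}.
Definition series (K : fieldType) (n : nat) := mi n -> K.

Definition tate (K : fieldType) (n : nat) (abs : K -> R) (f : series K n) : Prop :=
  forall eps, Rlt R0 eps -> exists N : nat, forall k : mi n,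
    (N <= \sum_(j < n) k j)%N -> Rlt (abs (f k)) eps.

Definition sadd (K : fieldType) (n : nat) (f g : series K n) : series K n :=
  fun k => f k + g k.

Definition smul (K : fieldType) (n : nat) (f g : series K n) : series K n :=
  fun k => \sum_(i : {ffun 'I_n -> 'I_((\sum_(j < n) k j).+1)} |
                   [forall j, (i j <= k j)%N])
             f [ffun j => nat_of_ord (i j)] * g [ffun j => (k j - i j)%N].

Definition mi0 (n : nat) : mi n := [ffun _ => 0%N].

Definition sone (K : fieldType) (n : nat) : series K n :=
  fun k => if k == mi0 n then 1 else 0.

(* the monomial z = last variable in d.+1 variables x_1..x_d, z *)
Definition zidx (d : nat) : mi d.+1 :=
  [ffun j : 'I_d.+1 => if j == ord_max then 1%N else 0%N].

Definition zminus (K : fieldType) (d : nat) (c : K) : series K d.+1 :=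
  fun k => if k == zidx d then 1 else if k == mi0 d.+1 then - c else 0.

(* A K<x_1..x_d,z>-module structure on the abelian group M; the action is
   only constrained on Tate series (coefficients tending to 0). *)
Record TateModule (K : fieldType) (abs : K -> R) (d : nat) (M : zmodType) := {
  act : series K d.+1 -> M -> M;
  act_addl : forall f g m, tate abs f -> tate abs g ->
      act (sadd f g) m = act f m + act g m;
  act_addr : forall f m m', tate abs f -> act f (m + m') = act f m + act f m';
  act_mull : forall f g m, tate abs f -> tate abs g ->
      act (smul f g) m = act f (act g m);
  act_one : forall m, act (@sone K d.+1) m = m
}.

Definition fin_gen (K : fieldType) (abs : K -> R) (d : nat) (M : zmodType)
    (A : TateModule abs d M) : Prop :=
  exists (n : nat) (g : 'I_n -> M), forall m : M,
    exists f : 'I_n -> series K d.+1,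
      (forall i, tate abs (f i)) /\ m = \sum_(i < n) act A (f i) (g i).

(* M|_{z=c} = M/(z-c)M = 0, i.e. M = (z-c)M *)
Definition vanishes_at (K : fieldType) (abs : K -> R) (d : nat) (M : zmodType)
    (A : TateModule abs d M) (c : K) : Prop :=
  forall m : M, exists m' : M, m = act A (@zminus K d c) m'.

Definition subring_of_o (K : fieldType) (abs : K -> R) (S : K -> Prop) : Prop :=
  (forall x, S x -> Rle (abs x) R1) /\ S 0 /\ S 1 /\
  (forall x y, S x -> S y -> S (x - y)) /\ (forall x y, S x -> S y -> S (x * y)).

Definition open_in (K : fieldType) (abs : K -> R) (S U : K -> Prop) : Prop :=
  forall c, S c -> U c -> exists delta, Rlt R0 delta /\
    forall c', S c' -> Rlt (abs (c' - c)) delta -> U c'.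

Definition compact_in (K : fieldType) (abs : K -> R) (S : K -> Prop) : Prop :=
  forall (I : Type) (U : I -> K -> Prop),
    (forall i, open_in abs S (U i)) ->
    (forall c, S c -> exists i, U i c) ->
    exists l : seq I, forall c, S c -> exists2 i, List.In i l & U i c.

(* Main.v *)
Require Import Defs.
From Stdlib Require Import Reals Lra Classical ClassicalEpsilon FunctionalExtensionality.
From HB Require Import structures.
From mathcomp Require Import all_boot all_order all_algebra.
Import Order.TTheory GRing.Theory Num.Theory.
Local Open Scope ring_scope.
Set Implicit Arguments. Unset Strict Implicit. Unset Printing Implicit Defensive.
Delimit Scope R_scope with Re.

(** Write M as a quotient of T^r, T the Tate algebra.  Call leading position of a
    nonzero vector the largest position (for a degree-compatible monomial order) at
    which a coefficient of maximal absolute value occurs.  By Dickson's lemma finitely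
    many vectors f_t of a submodule N of T^r have leading positions dividing all the
    others; reducing by the f_t shrinks any element of the closure of N by a uniform
    factor rho < 1, so it equals some sum q_t f_t with |q_t| bounded by its own norm.
    Thus submodules are closed and boundedly generated.

    Fix c, put y = z - c and let tors be the y-power torsion of M.  For x <> 0 small,
    y - x is invertible on tors, so M vanishes at c + x iff (y - x)M + tors = M.  By
    bounded generation of yM + tors, division by y is bounded modulo tors, and a
    perturbation argument shows that, for x small, this holds iff yM + tors = M.  Hence
    vanishing is constant on a punctured ball around every c in K.  Compactness of R
    gives the second claim; for Z the same argument is carried out on the tree of
    residue classes modulo p^k, whose infinite branches converge in K. *)

(** * Dickson's lemma *)

Section FiniteLists.

Lemma list_bound (T : eqType) (f : T -> R) (s : seq T) :
  exists B, (0 < B)%Re /\ forall x, x \in s -> (f x <= B)%Re.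
Proof.
elim: s => [|a s [B [B0 IH]]]; first by exists 1%Re; split=> //; lra.
exists (Rmax B (f a)); split; first by have := Rmax_l B (f a); lra.
move=> x; rewrite inE => /orP[/eqP->|/IH H]; first exact: Rmax_r.
by have := Rmax_l B (f a); lra.
Qed.

(** The lower bound [/2] keeps [rho] positive even for an empty list, and lets [rho] also bound the
    coefficients of a Tate vector outside a finite list once these are below [/2]. *)
Lemma list_bound_lt1 (T : eqType) (f : T -> R) (Q : T -> Prop) (s : seq T) :
  (forall x, Q x -> (f x < 1)%Re) ->
  exists rho, (/2 <= rho < 1)%Re /\
    forall x, x \in s -> Q x -> (f x <= rho)%Re.
Proof.
move=> f1; elim: s => [|a s [B [B0 IH]]]; first by exists (/2)%Re; split=> //; lra.
case: (classic (Q a)) => [Qa|nQ]; last first.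
  by exists B; split=> // x; rewrite inE => /orP[/eqP->|/IH].
exists (Rmax B (f a)); split.
  by have := Rmax_l B (f a); split; [lra|apply: Rmax_lub_lt; [lra|exact: f1]].
move=> x; rewrite inE => /orP[/eqP->|xs Qx]; first by move=> _; exact: Rmax_r.
by have := IH x xs Qx; have := Rmax_l B (f a); lra.
Qed.

Lemma list_max (T : eqType) (le : T -> T -> Prop) (s : seq T) (x0 : T) :
  (forall x y, le x y \/ le y x) ->
  (forall x y z, le x y -> le y z -> le x z) -> x0 \in s ->
  exists2 x, x \in s & forall y, y \in s -> le y x.
Proof.
move=> tot tr; elim: s x0 => // a s IH x0 _.
have lexx x : le x x by case: (tot x x).
case: s IH => [|b s] IH.
  by exists a; rewrite ?mem_head // => y; rewrite inE => /eqP->.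
have [x xs xm] := IH b (mem_head _ _).
case: (tot a x) => h.
  exists x; first by rewrite inE xs orbT.
  by move=> y; rewrite inE => /orP[/eqP->|/xm].
exists a; rewrite ?mem_head // => y; rewrite inE => /orP[/eqP->//|/xm yx].
exact: tr yx h.
Qed.

(** Induction on the number of coordinates. A finite list [l'] serves the first [k] of them; let [m]
    bound its values of [c k]. Elements with [c k x >= m] are dominated by [l'], and those below [m]
    fall into finitely many slices [c k x = m'], each treated by induction. *)
Lemma dickson (X : eqType) (c : nat -> X -> nat) (k : nat) (E : X -> Prop) :
  exists l : seq X, (forall y, y \in l -> E y) /\
    forall x, E x -> exists2 y, y \in l & forall j, (j < k)%N -> (c j y <= c j x)%N.
Proof.
elim: k E => [|k IH] E.
  case: (classic (exists x, E x)) => [[x Ex]|nE].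
    exists [:: x]; split=> [y|z _]; first by rewrite inE => /eqP->.
    by exists x; rewrite ?mem_head.
  by exists [::]; split=> // x Ex; case: nE; exists x.
have [l' [l'E l'b]] := IH E.
have [m lm] : exists m, forall y, y \in l' -> (c k y <= m)%N.
  elim: {l'E l'b} l' => [|a l [m IHm]]; first by exists 0%N.
  exists (maxn (c k a) m) => y; rewrite inE => /orP[/eqP->|/IHm h].
    exact: leq_maxl.
  exact: leq_trans h (leq_maxr _ _).
have [l2 [l2E l2b]] : exists l2 : seq X, (forall y, y \in l2 -> E y) /\
    forall x, E x -> (c k x < m)%N ->
      exists2 y, y \in l2 & forall j, (j < k.+1)%N -> (c j y <= c j x)%N.
  elim: (m) => [|m' [l2 [l2E l2b]]]; first by exists [::].
  have [l3 [l3E l3b]] := IH (fun x => E x /\ c k x = m').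
  exists (l2 ++ l3); split.
    by move=> y; rewrite mem_cat => /orP[/l2E//|/l3E[]].
  move=> x Ex; rewrite ltnS leq_eqVlt => /orP[/eqP xm|xm].
    have [y yl yx] := l3b x (conj Ex xm).
    exists y; first by rewrite mem_cat yl orbT.
    move=> j; rewrite ltnS leq_eqVlt => /orP[/eqP->|/yx//].
    by have [_ ->] := l3E _ yl; rewrite xm.
  have [y yl yx] := l2b x Ex xm.
  by exists y; rewrite // mem_cat yl.
exists (l' ++ l2); split.
  by move=> y; rewrite mem_cat => /orP[/l'E|/l2E].
move=> x Ex; case: (ltnP (c k x) m) => xm.
  by have [y yl yx] := l2b x Ex xm; exists y; rewrite // mem_cat yl orbT.
have [y yl yx] := l'b x Ex; exists y; first by rewrite mem_cat yl.
move=> j; rewrite ltnS leq_eqVlt => /orP[/eqP->|/yx//].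
exact: leq_trans (lm _ yl) xm.
Qed.

Lemma choice_fun (X Y : Type) (Q : X -> Y -> Prop) :
  (forall x, exists y, Q x y) -> exists f, forall x, Q x (f x).
Proof.
move=> h; exists (fun x => proj1_sig (constructive_indefinite_description _ (h x))).
by move=> x; case: constructive_indefinite_description.
Qed.

End FiniteLists.

(** * Multi-indices and their degrees *)

Section MultiIndices.
Variable n : nat.
Implicit Types k g : mi n.

Definition deg k : nat := (\sum_(j < n) k j)%N.
Definition mi_le g k : bool := [forall j, (g j <= k j)%N].
Definition mi_sub k g : mi n := [ffun j => (k j - g j)%N].

Lemma leq_deg k j : (k j <= deg k)%N.
Proof. by rewrite /deg (bigD1 j) //= leq_addr. Qed.

Lemma deg_sub k g : mi_le g k -> (deg g + deg (mi_sub k g) = deg k)%N.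
Proof.
move=> /forallP gk; rewrite /deg -big_split /=; apply: eq_bigr => j _.
by rewrite ffunE subnKC.
Qed.

Lemma mi_le0 k : mi_le (mi0 n) k.
Proof. by apply/forallP => j; rewrite ffunE. Qed.

Lemma mi_sub0 k : mi_sub k (mi0 n) = k.
Proof. by apply/ffunP => j; rewrite !ffunE subn0. Qed.

Lemma mi_subK k g : mi_le g k -> mi_sub k (mi_sub k g) = g.
Proof. by move=> /forallP gk; apply/ffunP => j; rewrite !ffunE subKn. Qed.

Lemma mi_le_sub k g : mi_le (mi_sub k g) k.
Proof. by apply/forallP => j; rewrite ffunE leq_subr. Qed.

Lemma deg_lt_finite (N : nat) : exists s : seq (mi n), forall k, (deg k < N)%N -> k \in s.
Proof.
exists (codom (fun u : {ffun 'I_n -> 'I_N} => [ffun j => val (u j)] : mi n)) => k kN.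
pose u : {ffun 'I_n -> 'I_N} := [ffun j => Ordinal (leq_ltn_trans (leq_deg k j) kN)].
have -> : k = [ffun j => val (u j)] by apply/ffunP => j; rewrite !ffunE.
exact: codom_f.
Qed.

End MultiIndices.

(** * Tate series *)

Section Valuation.
Variables (p : nat) (K : fieldType) (V : NAField p K).
Local Notation abs := (nabs V).

Lemma abs0 : abs 0 = 0%Re.
Proof. exact/nabs_eq0. Qed.

Lemma abs_gt0 x : x <> 0 -> (0 < abs x)%Re.
Proof.
move=> x0; case: (nabs_ge0 V x) => // e.
by case: x0; apply/(nabs_eq0 V).
Qed.

Lemma abs1 : abs 1 = 1%Re.
Proof.
have h := nabs_mul V 1 1; rewrite mulr1 in h.
have : (0 < abs 1)%Re by apply: abs_gt0; apply/eqP; rewrite oner_eq0.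
by nra.
Qed.

Lemma absN x : abs (- x) = abs x.
Proof.
have h : (abs (-1) * abs (-1) = 1)%Re by rewrite -nabs_mul mulrNN mulr1 abs1.
have := nabs_ge0 V (-1) => h0.
have e : abs (-1) = 1%Re by nra.
by rewrite -mulN1r nabs_mul e Rmult_1_l.
Qed.

Lemma abs_distC x y : abs (x - y) = abs (y - x).
Proof. by rewrite -absN opprB. Qed.

Lemma abs_add_le x y B : (abs x <= B)%Re -> (abs y <= B)%Re -> (abs (x + y) <= B)%Re.
Proof. by move=> hx hy; apply: Rle_trans (nabs_ultra V x y) _; apply: Rmax_lub. Qed.

Lemma abs_sub_le x y B : (abs x <= B)%Re -> (abs y <= B)%Re -> (abs (x - y) <= B)%Re.
Proof. by move=> hx hy; apply: abs_add_le => //; rewrite absN. Qed.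

Lemma abs_add_lt x y B : (abs x < B)%Re -> (abs y < B)%Re -> (abs (x + y) < B)%Re.
Proof. by move=> hx hy; apply: Rle_lt_trans (nabs_ultra V x y) _; apply: Rmax_lub_lt. Qed.

Lemma abs_mul_le x y B C :
  (abs x <= B)%Re -> (abs y <= C)%Re -> (abs (x * y) <= B * C)%Re.
Proof. by move=> hx hy; rewrite nabs_mul; apply: Rmult_le_compat => //; exact: nabs_ge0. Qed.

Lemma abs_sum_le (I : finType) (P : pred I) (F : I -> K) B :
  (0 <= B)%Re -> (forall i, P i -> (abs (F i) <= B)%Re) ->
  (abs (\sum_(i | P i) F i) <= B)%Re.
Proof.
move=> B0 FB; apply: (big_ind (fun x => Rle (abs x) B)) => //; first by rewrite abs0.
by move=> x y; exact: abs_add_le.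
Qed.

Lemma absV x : x <> 0 -> abs (x^-1) = (/ abs x)%Re.
Proof.
move=> /[dup] /abs_gt0 x0 /eqP x1; apply: Rmult_eq_reg_l (abs x) _ _ _ _; last by lra.
by rewrite -nabs_mul divff // abs1 Rinv_r //; lra.
Qed.

End Valuation.

Section TateSeries.
Variables (p : nat) (K : fieldType) (V : NAField p K) (n : nat).
Local Notation abs := (nabs V).
Local Notation series := (Defs.series K n).
Local Notation tate := (@Defs.tate K n abs).
Implicit Types (f g h : series) (k : mi n).

Definition nle f B := forall k, (abs (f k) <= B)%Re.
Definition ssub f g : series := fun k => f k - g k.
Definition mono (a : K) (e : mi n) : series := fun k => if k == e then a else 0.
Definition cst a := mono a (mi0 n).

Lemma nle_ge0 f B : nle f B -> (0 <= B)%Re.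
Proof. by move=> /(_ (mi0 n)); have := nabs_ge0 V (f (mi0 n)); lra. Qed.

Lemma nle_sub f g B : nle f B -> nle g B -> nle (ssub f g) B.
Proof. by move=> fB gB k; apply: abs_sub_le. Qed.

Lemma nle_mono a e B : (abs a <= B)%Re -> nle (mono a e) B.
Proof.
move=> aB k; rewrite /mono; case: eqP => // _.
by rewrite abs0; have := nabs_ge0 V a; lra.
Qed.

Lemma nle_smul f g B C : nle f B -> nle g C -> nle (smul f g) (B * C)%Re.
Proof.
move=> fB gC k; apply: abs_sum_le => [|i _]; last exact: abs_mul_le.
by apply: Rmult_le_pos; [exact: nle_ge0 fB|exact: nle_ge0 gC].
Qed.

Lemma tate_bounded f : tate f -> exists B, (0 < B)%Re /\ nle f B.
Proof.
move=> /(_ 1%Re Rlt_0_1)[N fN]; have [s sN] := deg_lt_finite n N.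
have [B [B0 sB]] := list_bound (fun k => abs (f k)) s.
exists (B + 1)%Re; split; first by lra.
move=> k; case: (ltnP (deg k) N) => kN; first by have := sB k (sN k kN); lra.
by have := fN k kN; lra.
Qed.

Lemma tate_sub f g : tate f -> tate g -> tate (ssub f g).
Proof.
move=> tf tg e e0; have [N fN] := tf e e0; have [N' gN] := tg e e0.
exists (N + N')%N => k kN; apply: abs_add_lt; rewrite ?absN.
  by apply: fN; apply: leq_trans kN; exact: leq_addr.
by apply: gN; apply: leq_trans kN; exact: leq_addl.
Qed.

Lemma tate_finsupp f N : (forall k, (N <= deg k)%N -> f k = 0) -> tate f.
Proof. by move=> fN e e0; exists N => k kN; rewrite fN // abs0. Qed.

Lemma tate_mono a e : tate (mono a e).
Proof.
apply: (@tate_finsupp _ (deg e).+1) => k; rewrite /mono; case: eqP => // ->.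
by rewrite ltnn.
Qed.

Lemma tate_cst a : tate (cst a). Proof. exact: tate_mono. Qed.

Lemma saddE f g : sadd f g = ssub f (ssub (fun=> 0) g).
Proof. by apply: functional_extensionality => k; rewrite /sadd /ssub sub0r opprK. Qed.

Lemma tate0 : tate (fun=> 0).
Proof. exact: (@tate_finsupp _ 0). Qed.

Lemma tate_add f g : tate f -> tate g -> tate (sadd f g).
Proof.
move=> tf tg; rewrite saddE; apply: tate_sub => //.
by apply: tate_sub => //; exact: tate0.
Qed.

Lemma smul_bound_pair f g k B : (0 <= B)%Re ->
  (forall e, mi_le e k -> (abs (f e * g (mi_sub k e)) <= B)%Re) ->
  (abs (smul f g k) <= B)%Re.
Proof.
move=> B0 H; apply: abs_sum_le => // i /forallP ik.
have /H : mi_le [ffun j => nat_of_ord (i j)] k.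
  by apply/forallP => j; rewrite ffunE.
congr (Rle (abs (_ * g _)) B).
by apply/ffunP => j; rewrite !ffunE.
Qed.

Lemma tate_smul f g : tate f -> tate g -> tate (smul f g).
Proof.
move=> tf tg e e0.
have [B [B0 fB]] := tate_bounded tf; have [C [C0 gC]] := tate_bounded tg.
have h1 : (0 < e / 2 / C)%Re by do 2?apply: Rdiv_lt_0_compat; lra.
have h2 : (0 < e / 2 / B)%Re by do 2?apply: Rdiv_lt_0_compat; lra.
have [N fN] := tf _ h1; have [N' gN] := tg _ h2.
exists (N + N')%N => k kN.
suff : (abs (smul f g k) <= e / 2)%Re by lra.
apply: smul_bound_pair => [|u uk]; first by lra.
have := deg_sub uk => dk.
(* Since [deg k >= N + N'], either [u] has degree at least [N] or its complement in [k] has degree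
   at least [N'], so one factor is small and the other bounded. *)
case: (leqP N (deg u)) => uN.
  have -> : (e / 2 = e / 2 / C * C)%Re by field; lra.
  apply: abs_mul_le => //; apply: Rlt_le; exact: fN.
have -> : (e / 2 = B * (e / 2 / B))%Re by field; lra.
apply: abs_mul_le => //; apply: Rlt_le; apply: gN.
rewrite -(leq_add2l (deg u)) -/(deg _) dk; apply: leq_trans kN.
by rewrite leq_add2r ltnW.
Qed.

Lemma smul_mono a e f k :
  smul (mono a e) f k = if mi_le e k then a * f (mi_sub k e) else 0.
Proof.
rewrite /smul; case: ifP => ek; last first.
  apply: big1 => i /forallP ik; rewrite /mono; case: eqP; last by rewrite mul0r.
  move=> ie; case/negP: ek; apply/forallP => j; rewrite -ie ffunE; exact: ik.
have /forallP ekj := ek.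
pose i0 : {ffun 'I_n -> 'I_((\sum_(j < n) k j).+1)} := [ffun j => inord (e j)].
have i0E j : i0 j = e j :> nat.
  by rewrite ffunE inordK // ltnS; apply: leq_trans (leq_deg k j).
rewrite (bigD1 i0) /=; last by apply/forallP => j; rewrite i0E.
rewrite [X in _ + X]big1 => [|i].
  rewrite [LHS]addr0; have -> : [ffun j => nat_of_ord (i0 j)] = e.
    by apply/ffunP => j; rewrite ffunE i0E.
  have -> : [ffun j => (k j - i0 j)%N] = mi_sub k e.
    by apply/ffunP => j; rewrite [LHS]ffunE [RHS]ffunE i0E.
  by rewrite /mono eqxx.
move=> /andP[_ ii0]; rewrite /mono; case: eqP; last by rewrite mul0r.
move=> ie; case/eqP: ii0; apply/ffunP => j; apply: val_inj.
by rewrite /= i0E -ie ffunE.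
Qed.

(** The convolution is reindexed along [i -> k - i], an involution on the multi-indices below
    [k]. *)
Lemma smulC f g : smul f g = smul g f.
Proof.
apply: functional_extensionality => k; rewrite /smul.
pose D := (\sum_(j < n) k j)%N.
pose h (i : {ffun 'I_n -> 'I_D.+1}) : {ffun 'I_n -> 'I_D.+1} :=
  [ffun j => inord (k j - i j)].
have hE i j : h i j = (k j - i j)%N :> nat.
  rewrite ffunE inordK // ltnS; apply: leq_trans (leq_subr _ _) (leq_deg k j).
rewrite (reindex_onto h h) /=; last first.
  move=> i /forallP ik; apply/ffunP => j; apply: val_inj.
  by rewrite /= !hE subKn.
apply: eq_big => [i|i /andP[/forallP ik /eqP hi]].
  apply/andP/forallP => [[_ /eqP hi] j|ik].
    by rewrite -hi hE leq_subr.
  split; first by apply/forallP => j; rewrite hE leq_subr.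
  by apply/eqP/ffunP => j; apply: val_inj; rewrite /= !hE subKn.
have hj j : (i j <= k j)%N.
  have <- : h (h i) j = i j by rewrite hi.
  by rewrite hE leq_subr.
have e1 : [ffun j => nat_of_ord (h i j)] = [ffun j => (k j - i j)%N].
  by apply/ffunP => j; rewrite [LHS]ffunE [RHS]ffunE hE.
have e2 : [ffun j => (k j - h i j)%N] = [ffun j => nat_of_ord (i j)].
  by apply/ffunP => j; rewrite [LHS]ffunE [RHS]ffunE hE subKn.
by rewrite mulrC e1 e2.
Qed.

Lemma smul_subl f g h : smul (ssub f g) h = ssub (smul f h) (smul g h).
Proof.
apply: functional_extensionality => k; rewrite /smul /ssub -sumrB.
by apply: eq_bigr => i _; rewrite mulrBl.
Qed.

End TateSeries.

(** * Monomial order and limits *)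

Section Positions.
Variables n r : nat.

Definition position := ('I_r * mi n)%type.
Implicit Types x y : position.

(* Degree first, so that only finitely many positions lie below a given one. *)
Definition key x : seqlexi nat :=
  deg x.2 :: nat_of_ord x.1 :: [seq x.2 j | j <- enum 'I_n].
Definition klt x y : bool := (key x < key y)%O.
Definition shift x (g : mi n) : position := (x.1, [ffun j => (x.2 j + g j)%N]).

Lemma key_inj : injective key.
Proof.
move=> [i k] [j l] [_ /val_inj -> /eq_in_map kl]; congr pair.
by apply/ffunP => t; apply: kl; rewrite mem_enum.
Qed.

(** Translation by [g] adds the same number to corresponding entries of both keys and leaves the
    component index alone, so the lexicographic comparison is unchanged. *)
Lemma klt_shift x y g : klt (shift x g) (shift y g) = klt x y.
Proof.
have dS z : deg (shift z g).2 = (deg z.2 + deg g)%N.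
  by rewrite /deg -big_split; apply: eq_bigr => j _; rewrite ffunE.
rewrite /klt /key !ltxi_cons !dS !leEnat !leq_add2r /=; do 2!congr (_ && (_ ==> _)).
elim: (enum 'I_n) => //= j s IH.
by rewrite !ltxi_cons !leEnat !ffunE !leq_add2r IH.
Qed.

Lemma klt_deg x y : (deg x.2 < deg y.2)%N -> klt x y.
Proof. by move=> xy; rewrite /klt /key ltxi_cons !leEnat (ltnW xy) leqNgt xy. Qed.

Lemma klt_trans x y z : klt x y -> klt y z -> klt x z.
Proof. exact: lt_trans. Qed.

Lemma klt_total x y : x <> y -> klt x y \/ klt y x.
Proof.
move=> xy; case: (ltgtP (key x) (key y)) => [h|h|/key_inj//].
  by left.
by right.
Qed.

Lemma klt_irr x : klt x x = false.
Proof. exact: ltxx. Qed.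

Lemma shift_sub x y : x.1 = y.1 -> mi_le x.2 y.2 -> shift x (mi_sub y.2 x.2) = y.
Proof.
case: x y => [i k] [j l] /= <- /forallP kl; congr pair.
by apply/ffunP => t; rewrite !ffunE subnKC.
Qed.

Lemma sub_shift x (g : mi n) : mi_le g x.2 -> shift (x.1, mi_sub x.2 g) g = x.
Proof.
case: x => [i k] /= /forallP gk; congr pair.
by apply/ffunP => t; rewrite !ffunE subnK.
Qed.

Lemma pos_lt_finite (N : nat) :
  exists s : seq position, forall x, (deg x.2 < N)%N -> x \in s.
Proof.
have [s sN] := deg_lt_finite n N.
exists [seq (i, k) | i <- enum 'I_r, k <- s] => -[i k] /= kN.
by apply/allpairsP; exists (i, k); rewrite mem_enum sN.
Qed.

Lemma pos_dickson (E : position -> Prop) :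
  exists l : seq position, (forall y, y \in l -> E y) /\
    forall x, E x -> exists2 y, y \in l & y.1 = x.1 /\ mi_le y.2 x.2.
Proof.
(* The first two coordinates, [i] and [r - i], force equality of the components. *)
pose c j (x : position) : nat := match j with
  | 0 => x.1 | 1 => (r - x.1)%N
  | j'.+2 => if insub j' is Some t then x.2 t else 0%N end.
have [l [lE lb]] := @dickson position c n.+2 E; exists l; split=> // x /lb[y yl yx].
exists y => //; split; last first.
  by apply/forallP => t; have := yx t.+2 (ltn_ord t); rewrite /c valK.
apply: val_inj; apply/eqP; rewrite eqn_leq (yx 0%N) //=.
have := yx 1%N isT; rewrite /c leq_sub2lE //; exact: ltnW.
Qed.

End Positions.

Section Limits.
Variables (p : nat) (K : fieldType) (V : NAField p K) (n : nat).
Local Notation abs := (nabs V).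
Local Notation series := (Defs.series K n).
Local Notation tate := (@Defs.tate K n abs).

Lemma pow_small (rho B eps : R) : (0 < rho < 1)%Re -> (0 < eps)%Re -> (0 <= B)%Re ->
  exists J : nat, forall j, (J <= j)%N -> (rho ^ j * B < eps)%Re.
Proof.
move=> [r0 r1] e0 B0.
have a1 : (Rabs rho < 1)%Re by rewrite Rabs_right; lra.
have e1 : (0 < eps / (B + 1))%Re by apply: Rdiv_lt_0_compat; lra.
have [J HJ] := pow_lt_1_zero rho a1 _ e1.
exists J => j /ssrnat.leP Jj; have := HJ j Jj.
have pj := pow_lt rho j r0; rewrite Rabs_right; last by lra.
move=> h; have : (rho ^ j * (B + 1) < eps / (B + 1) * (B + 1))%Re by nra.
have -> : (eps / (B + 1) * (B + 1) = eps)%Re by field; lra.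
by nra.
Qed.

Lemma le_small x B : (0 <= B)%Re -> (forall eps, (0 < eps)%Re -> (abs x <= Rmax B eps)%Re) ->
  (abs x <= B)%Re.
Proof.
move=> B0 h; case: (Rle_lt_dec (abs x) B) => // Bx.
have e0 : (0 < (B + abs x) / 2)%Re by lra.
have := h _ e0; rewrite /Rmax; case: Rle_dec; lra.
Qed.

Lemma eq0_small x : (forall eps, (0 < eps)%Re -> (abs x <= eps)%Re) -> x = 0.
Proof.
move=> h; apply/(nabs_eq0 V); have := nabs_ge0 V x => x0.
by case: (Rle_lt_dec (abs x) 0) => x1; [lra|have := h (abs x / 2)%Re; lra].
Qed.

(** By the ultrametric inequality all increments from stage [J] on sum to at most [rho ^ J * B],
    uniformly in the coefficient. The coefficientwise limit is therefore uniform, hence again Tate,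
    and stage 0 gives the bound [B]. *)
Lemma tate_limit (P : nat -> series) (rho B : R) :
  (0 < rho < 1)%Re -> (0 <= B)%Re -> P 0%N = (fun=> 0) -> (forall J, tate (P J)) ->
  (forall J, nle V (ssub (P J.+1) (P J)) (rho ^ J * B)) ->
  exists Q, tate Q /\ nle V Q B /\ forall J, nle V (ssub Q (P J)) (rho ^ J * B).
Proof.
move=> r01 B0 P0 tP dP.
have pw J : (0 <= rho ^ J * B)%Re.
  by apply: Rmult_le_pos => //; apply: pow_le; lra.
have pd J i : (rho ^ (J + i) * B <= rho ^ J * B)%Re.
  rewrite -plusE pow_add; have h1 := pow_le rho J ltac:(lra).
  have := pow_incr rho 1 i ltac:(lra); rewrite pow1 => h2.
  have h3 := pow_le rho i ltac:(lra).
  by apply: Rmult_le_compat_r => //; nra.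
have cP J i k : (abs (P (J + i)%N k - P J k) <= rho ^ J * B)%Re.
  elim: i => [|i IH]; first by rewrite addn0 subrr abs0.
  have -> : P (J + i.+1)%N k - P J k =
            (P (J + i).+1 k - P (J + i)%N k) + (P (J + i)%N k - P J k).
    by rewrite addnS addrA subrK.
  by apply: abs_add_le => //; apply: Rle_trans (pd J i); exact: dP.
have lim k : exists l, forall J, (abs (l - P J k) <= rho ^ J * B)%Re.
  have [|l hl] := @nabs_complete p K V (fun J => P J k).
    move=> e e0; have [J HJ] := pow_small r01 e0 B0.
    exists J => a b Ja Jb; apply: Rle_lt_trans _ (HJ J (leqnn _)).
    rewrite -(subnKC Ja) -(subnKC Jb).
    rewrite -[X in (abs X <= _)%Re](subrKA (P J k)) -(opprB _ (P J k)).
    by apply: abs_sub_le; exact: cP.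
  exists l => J; apply: le_small => // e e0; have [N HN] := hl e e0.
  have hlt := HN (J + N)%N (leq_addl _ _); rewrite abs_distC.
  rewrite -(subrKA (P (J + N)%N k)); apply: abs_add_le.
    by rewrite abs_distC; exact: Rle_trans (cP _ _ _) (Rmax_l _ _).
  exact: Rle_trans (Rlt_le _ _ hlt) (Rmax_r _ _).
pose Q : series := fun k => proj1_sig (constructive_indefinite_description _ (lim k)).
have QP J : nle V (ssub Q (P J)) (rho ^ J * B).
  move=> k; rewrite /ssub /Q; case: constructive_indefinite_description => l /= h.
  exact: h.
exists Q; split; last first.
  split=> // k; have := QP 0%N k; rewrite /ssub P0 subr0 pow_O.
  by rewrite Rmult_1_l.
move=> e e0; have [J HJ] := pow_small r01 e0 B0; have [N HN] := tP J e e0.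
exists N => k kN; rewrite -(subrK (P J k) (Q k)); apply: abs_add_lt; last exact: HN.
by apply: Rle_lt_trans (HJ J (leqnn _)); exact: QP.
Qed.

End Limits.

(** * Division in free modules *)

Section Division.
Variables (p : nat) (K : fieldType) (V : NAField p K) (n r : nat).
Local Notation abs := (nabs V).
Local Notation series := (Defs.series K n).
Local Notation tate := (@Defs.tate K n abs).
Local Notation nle := (nle V).

Definition vec := 'I_r -> series.
Local Notation position := (position n r).
Implicit Types (F G f g : vec) (x y z : position).

Definition at_ F x := F x.1 x.2.
Definition vtate F := forall i, tate (F i).
Definition vle F B := forall x, (abs (at_ F x) <= B)%Re.
Definition vsub F G : vec := fun i => ssub (F i) (G i).
Definition vsmul q F : vec := fun i => smul q (F i).
Definition comb s (q : 'I_s -> series) (f : 'I_s -> vec) : vec :=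
  fun i k => \sum_t smul (q t) (f t i) k.

Lemma vec_ext F G : (forall x, at_ F x = at_ G x) -> F = G.
Proof.
move=> h; apply: functional_extensionality => i.
by apply: functional_extensionality => k; exact: (h (i, k)).
Qed.

Lemma vtate_sub F G : vtate F -> vtate G -> vtate (vsub F G).
Proof. by move=> tF tG i; apply: tate_sub. Qed.

Lemma vle_sub F G B : vle F B -> vle G B -> vle (vsub F G) B.
Proof. by move=> FB GB x; apply: abs_sub_le; [exact: FB|exact: GB]. Qed.

Lemma vle_trans F B C : (B <= C)%Re -> vle F B -> vle F C.
Proof. by move=> BC FB x; apply: Rle_trans (FB x) BC. Qed.

Lemma vtate_small F eps : vtate F -> (0 < eps)%Re ->
  exists N, forall x, (N <= deg x.2)%N -> (abs (at_ F x) < eps)%Re.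
Proof.
move=> tF e0; have [N HN] := choice_fun (fun i => tF i eps e0).
exists (\max_i N i)%N => -[i k] /= kN; apply: HN.
exact: leq_trans (leq_bigmax i) kN.
Qed.

Definition LT F x := at_ F x <> 0 /\ (forall y, (abs (at_ F y) <= abs (at_ F x))%Re) /\
  forall y, klt x y -> (abs (at_ F y) < abs (at_ F x))%Re.

(** Only finitely many positions carry a coefficient at least as large as the one at [x0]. Among
    them a maximum is taken for the order that compares absolute values first and breaks ties by
    [klt]. *)
Lemma LT_exists F x0 : vtate F -> at_ F x0 <> 0 -> exists x, LT F x.
Proof.
move=> tF F0; have e0 := abs_gt0 V F0.
have [N HN] := vtate_small tF e0; have [s sN] := pos_lt_finite n r N.
pose le x y := (abs (at_ F x) < abs (at_ F y))%Re \/
  (abs (at_ F x) = abs (at_ F y) /\ (x = y \/ klt x y)).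
have le_tot x y : le x y \/ le y x.
  rewrite /le; case: (Rtotal_order (abs (at_ F x)) (abs (at_ F y))) => [h|[h|h]].
  - by left; left.
  - case: (classic (x = y)) => [->|/klt_total[h'|h']].
    + by left; right; split=> //; left.
    + by left; right; split=> //; right.
    + by right; right; split=> //; right.
  - by right; left.
have le_tr x y z : le x y -> le y z -> le x z.
  rewrite /le => -[h1|[h1 h1']] [h2|[h2 h2']]; try (left; lra).
  right; split; first by lra.
  case: h1' => [->//|h1']; case: h2' => [<-|h2']; first by right.
  by right; exact: klt_trans h1' h2'.
have sx0 : x0 \in s.
  by apply: sN; rewrite ltnNge; apply/negP => /HN; lra.
have [x xs xm] := list_max le_tot le_tr sx0.
have ex0 : (abs (at_ F x0) <= abs (at_ F x))%Re.
  by case: (xm _ sx0) => [|[]]; lra.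
have out y : y \notin s -> (abs (at_ F y) < abs (at_ F x))%Re.
  move=> ys; apply: Rlt_le_trans ex0; apply: HN; rewrite leqNgt.
  by apply: contra ys; exact: sN.
exists x; split.
  by move=> e; move: ex0; rewrite e abs0; lra.
split=> y.
  by case: (boolP (y \in s)) => [/xm[|[]]|/out]; lra.
move=> xy; case: (boolP (y \in s)) => [/xm[//|[_ [yx|yx]]]|/out//].
  by move: xy; rewrite yx klt_irr.
by have := klt_trans xy yx; rewrite klt_irr.
Qed.

Section Submodule.
Variable N : vec -> Prop.
Hypothesis N_tate : forall F, N F -> vtate F.
Hypothesis N_sub : forall F G, N F -> N G -> N (vsub F G).
Hypothesis N_smul : forall q F, tate q -> N F -> N (vsmul q F).
Hypothesis N_0 : N (fun _ _ => 0).

Lemma smul_cst a (f : series) k : smul (cst a) f k = a * f k.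
Proof. by rewrite smul_mono mi_le0 mi_sub0. Qed.

(** Dickson's lemma selects finitely many leading positions, and the chosen vectors are scaled to
    have leading coefficient 1. Beyond its leading position each has coefficients strictly below 1,
    all but finitely many below [/2], so a single [rho < 1] bounds them all. *)
Lemma standard_basis : exists s (f : 'I_s -> vec) (y : 'I_s -> position) (rho : R),
  (0 < rho < 1)%Re /\
  (forall t, [/\ N (f t), at_ (f t) (y t) = 1, vle (f t) 1 &
     forall z, klt (y t) z -> (abs (at_ (f t) z) <= rho)%Re]) /\
  forall F x, N F -> LT F x -> exists t, (y t).1 = x.1 /\ mi_le (y t).2 x.2.
Proof.
have [l [lE lb]] := pos_dickson (fun x => exists F, N F /\ LT F x).
pose y (t : 'I_(size l)) := tnth (in_tuple l) t.
have yl t : y t \in l by rewrite mem_tnth.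
pose good t (w : vec * R) := [/\ N w.1, at_ w.1 (y t) = 1, vle w.1 1,
     (w.2 < 1)%Re & forall z, klt (y t) z -> (abs (at_ w.1 z) <= w.2)%Re].
have [w Hw] : exists w, forall t, good t (w t).
  apply: choice_fun => t; have [F [NF [F0 [F1 F2]]]] := lE _ (yl t).
  pose G := vsmul (cst (at_ F (y t))^-1) F.
  have GE z : at_ G z = (at_ F (y t))^-1 * at_ F z by exact: smul_cst.
  have F0' := abs_gt0 V F0.
  have absG z : abs (at_ G z) = (/ abs (at_ F (y t)) * abs (at_ F z))%Re.
    by rewrite GE nabs_mul absV.
  have NG : N G by apply: N_smul => //; exact: tate_cst.
  have G1 z : (abs (at_ G z) <= 1)%Re.
    rewrite absG -(Rinv_l (abs (at_ F (y t)))); last by lra.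
    by apply: Rmult_le_compat_l; [apply/Rlt_le/Rinv_0_lt_compat|].
  have G2 z : klt (y t) z -> (abs (at_ G z) < 1)%Re.
    move=> yz; rewrite absG -(Rinv_l (abs (at_ F (y t)))); last by lra.
    by apply: Rmult_lt_compat_l; [apply/Rinv_0_lt_compat|exact: F2].
  have [D HD] := vtate_small (N_tate NG) (ltac:(lra) : (0 < /2)%Re).
  have [s sD] := pos_lt_finite n r D.
  have [rho [rho1 Hrho]] :=
    list_bound_lt1 (f := fun z => abs (at_ G z)) (Q := klt (y t)) s G2.
  exists (G, rho); split=> //=; first by rewrite GE mulVf //; apply/eqP.
    by lra.
  move=> z yz; case: (ltnP (deg z.2) D) => zD; first exact: Hrho (sD _ zD) yz.
  by have := HD z zD; lra.
have w1 t : True -> ((w t).2 < 1)%Re by move=> _; case: (Hw t).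
have [rho [rho1 Hrho]] := list_bound_lt1 (enum 'I_(size l)) w1.
exists (size l), (fun t => (w t).1), y, rho; split; first by lra.
split.
  move=> t; have [h1 h2 h3 h4 h5] := Hw t; split=> // z /h5 h.
  by apply: Rle_trans h _; apply: Hrho; rewrite ?mem_enum.
move=> F x NF Fx; have [z zl zx] := lb x (ex_intro _ F (conj NF Fx)).
have /tnthP[t zt] : z \in in_tuple l by [].
by exists t; rewrite /y -zt.
Qed.

Lemma comb0 s (f : 'I_s -> vec) : comb (fun _ _ => 0) f = (fun _ _ => 0).
Proof.
apply: vec_ext => x; rewrite /at_ /comb big1 // => t _.
by rewrite /smul big1 // => i _; rewrite mul0r.
Qed.

Lemma comb_sub s (q q' : 'I_s -> series) (f : 'I_s -> vec) :
  comb (fun t => ssub (q t) (q' t)) f = vsub (comb q f) (comb q' f).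
Proof.
apply: vec_ext => x; rewrite /at_ /comb /vsub /ssub -sumrB.
by apply: eq_bigr => t _; rewrite smul_subl.
Qed.

Lemma vle_comb s (q : 'I_s -> series) (f : 'I_s -> vec) B : (0 <= B)%Re ->
  (forall t, nle (q t) B) -> (forall t, vle (f t) 1) -> vle (comb q f) B.
Proof.
move=> B0 qB f1 x; apply: abs_sum_le => // t _.
rewrite -(Rmult_1_r B); apply: nle_smul => // k; exact: (f1 t (x.1, k)).
Qed.

Lemma N_comb s (q : 'I_s -> series) (f : 'I_s -> vec) :
  (forall t, tate (q t)) -> (forall t, N (f t)) -> N (comb q f).
Proof.
have N_ext F G : (forall x, at_ F x = at_ G x) -> N F -> N G by move=> /vec_ext->.
move=> tq Nf; rewrite /comb; elim: (index_enum 'I_s) => [|t l IH].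
  by apply: (N_ext _ _ _ N_0) => x; rewrite /at_ big_nil.
apply: (N_ext _ _ _ (N_sub (N_smul (tq t) (Nf t)) (N_sub N_0 IH))) => x.
by rewrite /at_ /vsub /ssub big_cons sub0r opprK.
Qed.

(** * Reduction by a standard basis *)

Section Sweep.
Variables (s : nat) (f : 'I_s -> vec) (y : 'I_s -> position) (rho B : R).
Hypothesis (rho01 : (0 < rho < 1)%Re) (B0 : (0 < B)%Re).
Hypothesis f_std : forall t, [/\ N (f t), at_ (f t) (y t) = 1, vle (f t) 1 &
     forall z, klt (y t) z -> (abs (at_ (f t) z) <= rho)%Re].

Definition lead x := exists t, (y t).1 = x.1 /\ mi_le (y t).2 x.2.

Let f1 t : vle (f t) 1. Proof. by case: (f_std t). Qed.

(** Subtract [at_ g x] times the monomial multiple of [f t] whose leading position is [x]. As [klt]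
    is translation invariant, later positions change by at most [rho * B], whereas earlier ones may
    change by as much as [B]. *)
Lemma cancel_at x g : lead x -> vle g B -> exists q,
  [/\ forall t, tate (q t), forall t, nle (q t) B,
   at_ (vsub g (comb q f)) x = 0 &
   forall z, klt x z -> (abs (at_ (comb q f) z) <= rho * B)%Re].
Proof.
move=> [t [t1 t2]] gB; have [Nf fy _ frho] := f_std t.
pose e := mi_sub x.2 (y t).2; have xe : shift (y t) e = x by exact: shift_sub.
pose q t' := if t' == t then mono (at_ g x) e else (fun=> 0).
have qE z : at_ (comb q f) z =
    if mi_le e z.2 then at_ g x * at_ (f t) (z.1, mi_sub z.2 e) else 0.
  rewrite /at_ /comb (bigD1 t) //= [X in _ + X]big1 => [|t' /negPf tt'].
    by rewrite addr0 /q eqxx smul_mono.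
  by rewrite /q tt' /smul big1 // => i _; rewrite mul0r.
exists q; split.
- move=> t'; rewrite /q; case: eqP => _; [exact: tate_mono|exact: tate0].
- move=> t'; rewrite /q; case: eqP => _; first exact: nle_mono.
  by move=> k; rewrite abs0; lra.
- rewrite /at_ /vsub /ssub -/(at_ g x) -/(at_ (comb q f) x) qE.
  rewrite mi_le_sub mi_subK // -t1 -surjective_pairing fy mulr1; exact: subrr.
- move=> z xz; rewrite qE; case: ifP => [ez|_]; last first.
    by rewrite abs0; nra.
  rewrite Rmult_comm; apply: abs_mul_le => //; apply: frho.
  by rewrite -(klt_shift _ _ e) xe sub_shift.
Qed.

(** The list [l] is an initial segment of positions still to be treated, and is emptied from its
    largest element downwards. Cancelling there disturbs the later positions, already treated, by at
    most [rho * B]. The quotients add up without exceeding [B] because the norm is ultrametric. *)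
Lemma sweep_list m (l : seq position) g : (size l <= m)%N ->
  (forall x z, x \notin l -> z \in l -> klt z x) -> vtate g -> vle g B ->
  (forall x, lead x -> x \notin l -> (abs (at_ g x) <= rho * B)%Re) ->
  exists q, [/\ forall t, tate (q t), forall t, nle (q t) B &
    forall x, lead x -> (abs (at_ (vsub g (comb q f)) x) <= rho * B)%Re].
Proof.
elim: m l g => [|m IH] l g.
  rewrite leqn0 size_eq0 => /eqP -> _ tg gB gl; exists (fun _ _ => 0); split.
  - by move=> _; exact: tate0.
  - by move=> _ k; rewrite abs0; lra.
  - move=> x xl; rewrite comb0 /at_ /vsub /ssub subr0; exact: gl.
move=> lm up tg gB gl.
case: l lm up gl => [|x0 l0] lm up gl.
  by apply: (IH [::] g).
set l := x0 :: l0 in lm up gl.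
have [x xl xm] : exists2 x, x \in l & forall z, z \in l -> z = x \/ klt z x.
  apply: (@list_max _ (fun a b => a = b \/ klt a b) _ x0); last exact: mem_head.
    move=> a b; case: (classic (a = b)) => [->|/klt_total[]]; auto.
  move=> a b c [->//|ab] [<-|bc]; first by right.
  by right; apply: klt_trans ab bc.
pose l' := [seq z <- l | predC (pred1 x) z].
have l'E z : z \in l' = (z != x) && (z \in l) by rewrite mem_filter.
have l'm : (size l' <= m)%N.
  rewrite -ltnS; apply: leq_trans lm; rewrite /l' size_filter -(count_predC (pred1 x) l).
  by rewrite -addn1 addnC leq_add2r -has_count has_pred1.
have up' z w : z \notin l' -> w \in l' -> klt w z.
  rewrite !l'E negb_and negbK => h /andP[wx wl].
  have wltx : klt w x by case: (xm w wl) => // e; rewrite e eqxx in wx.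
  by case/orP: h => [/eqP->//|zl]; exact: up.
case: (classic (lead x)) => [lx|nlx]; last first.
  apply: (IH l') => // z lz; rewrite l'E negb_and negbK => /orP[/eqP e|]; last exact: gl.
  by rewrite e in lz.
have [q1 [tq1 q1B q1x q1z]] := cancel_at lx gB.
have g1B : vle (vsub g (comb q1 f)) B.
  by apply: vle_sub => //; apply: vle_comb => //; lra.
have tg1 : vtate (vsub g (comb q1 f)).
  by apply: vtate_sub => //; apply: N_tate; apply: N_comb => // t; case: (f_std t).
have [z lz|q2 [tq2 q2B q2x]] := IH l' _ l'm up' tg1 g1B.
  rewrite l'E negb_and negbK => /orP[/eqP ->|zl].
    by rewrite q1x abs0; nra.
  by apply: abs_sub_le; [exact: gl|apply: q1z; exact: up].
(* The nested [ssub] is the sum of [q2 t] and [q1 t]. *)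
exists (fun t => ssub (q2 t) (ssub (fun=> 0) (q1 t))); split.
- move=> t; do 2?apply: tate_sub => //; exact: tate0.
- move=> t; do 2?apply: nle_sub => //; move=> k; rewrite abs0; lra.
- move=> z lz; have := q2x z lz; congr (Rle (abs _) _).
  rewrite !comb_sub comb0 /at_ /vsub /ssub sub0r opprK.
  by rewrite -addrA opprD [in RHS](addrC (- _)).
Qed.

Hypothesis lead_N : forall F x, N F -> LT F x -> lead x.

(** After the sweep the remainder is small only at the positions in [lead]. Compare it with [g2] in
    [N], which differs from it by at most [rho * B]: the leading position of [g2] is in [lead], so
    the leading coefficient, and with it all of [g2], is at most [rho * B]. Hence the whole
    remainder is small. *)
Lemma sweep g : vtate g -> vle g B ->
  (forall eps, (0 < eps)%Re -> exists g1, N g1 /\ vle (vsub g g1) eps) ->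
  exists q, [/\ forall t, tate (q t), forall t, nle (q t) B &
    vle (vsub g (comb q f)) (rho * B)].
Proof.
move=> tg gB gcl; have rB : (0 < rho * B)%Re by nra.
have [D HD] := vtate_small tg rB; have [l0 lD] := pos_lt_finite n r D.
(* From degree [D] on the coefficients of [g] are already below [rho * B]. The positions of smaller
   degree form an initial segment, because the order compares degrees first. *)
pose l := [seq x <- l0 | (deg x.2 < D)%N].
have lE x : (x \in l) = (deg x.2 < D)%N.
  by rewrite mem_filter; case: ltnP => // /lD ->.
have [x z|x _|q [tq qB qE]] := @sweep_list (size l) l g (leqnn _) _ tg gB.
- rewrite !lE -leqNgt => Dx zD; apply: klt_deg; exact: leq_trans zD Dx.
- by rewrite lE -leqNgt => /HD; lra.
exists q; split=> //; have Nq : N (comb q f).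
  by apply: N_comb => // t; case: (f_std t).
have [g1 [Ng1 g1B]] := gcl _ rB; pose g2 := vsub g1 (comb q f).
have Ng2 : N g2 by exact: N_sub.
have gg2 x : at_ (vsub g (comb q f)) x = at_ (vsub g g1) x + at_ g2 x.
  by rewrite /at_ /g2 /vsub /ssub subrKA.
suff g2B : vle g2 (rho * B) by move=> x; rewrite gg2; apply: abs_add_le.
case: (classic (exists x, at_ g2 x <> 0)) => [[x0 g20]|g20]; last first.
  move=> x; have -> : at_ g2 x = 0 by apply: NNPP => h; apply: g20; exists x.
  by rewrite abs0; lra.
have [x ltx] := LT_exists (N_tate Ng2) g20.
have h : (abs (at_ g2 x) <= rho * B)%Re.
  have -> : at_ g2 x = at_ (vsub g (comb q f)) x - at_ (vsub g g1) x.
    by rewrite gg2 addrC addKr.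
  by apply: abs_sub_le => //; apply: qE; exact: lead_N ltx.
by move=> z; case: ltx => _ [/(_ z) h' _]; lra.
Qed.

End Sweep.

(** Repeated sweeps give partial quotients with increments at most [rho ^ J * B], whose limit is
    [q]. Assuming only that [g] is in the closure of [N] yields closedness of [N] together with the
    bound on [q]. *)
Theorem division : exists s (f : 'I_s -> vec), (forall t, N (f t)) /\
  forall B g, (0 < B)%Re -> vtate g -> vle g B ->
  (forall eps, (0 < eps)%Re -> exists g1, N g1 /\ vle (vsub g g1) eps) ->
  exists q, [/\ forall t, tate (q t), forall t, nle (q t) B & g = comb q f].
Proof.
have [s [f [y [rho [r01 [fstd flead]]]]]] := standard_basis.
exists s, f; split; first by move=> t; case: (fstd t).
have Nf t : N (f t) by case: (fstd t).
have f1 t : vle (f t) 1 by case: (fstd t).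
move=> B g B0 tg gB gcl.
have pw J : (0 < rho ^ J * B)%Re.
  by apply: Rmult_lt_0_compat => //; apply: pow_lt; lra.
pose inv J (P : 'I_s -> series) := (forall t, tate (P t)) /\
  vle (vsub g (comb P f)) (rho ^ J * B).
(* Placing the invariant in a premise makes this relation total, so that choice yields a step
   function; [invP] later supplies the premise. *)
pose nxt (JP : nat * ('I_s -> series)) (P' : 'I_s -> series) := let: (J, P) := JP in
  inv J P -> inv J.+1 P' /\ forall t, nle (ssub (P' t) (P t)) (rho ^ J * B).
have [step Hstep] : exists step, forall JP, nxt JP (step JP).
  apply: choice_fun => -[J P]; rewrite /nxt /=.
  case: (classic (inv J P)) => [[tP gP]|nP]; last by exists P.
  have [|eps e0|q [tq qB qg]] := @sweep s f y rho (rho ^ J * B) r01 (pw J) fstd flead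
    (vsub g (comb P f)) _ gP.
  - by apply: vtate_sub => //; apply: N_tate; exact: N_comb.
  - have [g1 [Ng1 gg1]] := gcl eps e0; exists (vsub g1 (comb P f)); split.
      by apply: N_sub => //; exact: N_comb.
    move=> x; have := gg1 x; congr (Rle (abs _) _).
    by rewrite /at_ /vsub /ssub opprB addrA subrK.
  exists (fun t => ssub (P t) (ssub (fun=> 0) (q t))) => _; split; last first.
    move=> t k; have := qB t k; congr (Rle (abs _) _).
    by rewrite /ssub sub0r opprK addrC addKr.
  split; first by move=> t; do 2?apply: tate_sub => //; exact: tate0.
  move=> x; have := qg x; rewrite -Rmult_assoc; congr (Rle (abs _) _).
  by rewrite !comb_sub comb0 /at_ /vsub /ssub sub0r opprK opprD addrA.
pose P := fix P J : 'I_s -> series := if J is J'.+1 then step (J', P J') else fun _ _ => 0.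
have invP J : inv J (P J).
  elim: J => [|J IH]; last by have [] := Hstep (J, P J) IH.
  split=> [t|x]; first exact: tate0.
  by rewrite /= Rmult_1_l comb0 /at_ /vsub /ssub subr0; exact: gB.
have dP J t : nle (ssub (P J.+1 t) (P J t)) (rho ^ J * B).
  by have [_] := Hstep (J, P J) (invP J); exact.
have [q Hq] := choice_fun (fun t => @tate_limit _ _ V n (P^~ t) rho B r01 (Rlt_le _ _ B0)
  erefl (fun J => (invP J).1 t) (fun J => dP J t)).
exists q; split; try by move=> t; case: (Hq t) => ? [].
apply: vec_ext => x; apply/eqP; rewrite -subr_eq0; apply/eqP.
apply: (@eq0_small _ _ V) => eps e0; have [J HJ] := pow_small r01 e0 (Rlt_le _ _ B0).
apply: Rle_trans (Rlt_le _ _ (HJ J (leqnn _))).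
have h := @vle_comb _ (fun t => ssub (q t) (P J t)) f _ (Rlt_le _ _ (pw J)) _ f1 x.
have {}h := h (fun t => (Hq t).2.2 J).
have -> : at_ g x - at_ (comb q f) x =
    at_ (vsub g (comb (P J) f)) x - at_ (comb (fun t => ssub (q t) (P J t)) f) x.
  by rewrite comb_sub /at_ /vsub /ssub opprB addrA subrK.
by apply: abs_sub_le => //; exact: (invP J).2.
Qed.

End Submodule.
End Division.

(** * Modules over the Tate algebra *)

Section Modules.
Variables (p : nat) (K : fieldType) (V : NAField p K) (d : nat) (M : zmodType).
Variable A : TateModule (nabs V) d M.
Local Notation abs := (nabs V).
Local Notation series := (Defs.series K d.+1).
Local Notation tate := (@Defs.tate K d.+1 abs).
Local Notation nle := (nle V).
Local Notation act := (act A).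
Local Notation zm c := (@zminus K d c).
Local Notation cst := (@cst K d.+1).
Implicit Types (f g q : series) (m : M) (c x : K).

Lemma act_subl f g m : tate f -> tate g -> act (ssub f g) m = act f m - act g m.
Proof.
move=> tf tg; apply/eqP; rewrite eq_sym subr_eq -act_addl //; last exact: tate_sub.
by apply/eqP; congr Defs.act; apply: functional_extensionality => k; rewrite /sadd /ssub subrK.
Qed.

Lemma act0r f : tate f -> act f 0 = 0.
Proof. by move=> tf; have := act_addr A 0 0 tf; rewrite addr0 -[LHS]addr0 => /addrI. Qed.

Lemma act_subr f m m' : tate f -> act f (m - m') = act f m - act f m'.
Proof. by move=> tf; apply/eqP; rewrite eq_sym subr_eq -act_addr // subrK. Qed.

Lemma act0l m : act (fun=> 0) m = 0.
Proof.
have := act_subl m (@tate0 _ _ V d.+1) (@tate0 _ _ V d.+1); rewrite subrr => <-.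
by congr Defs.act; apply: functional_extensionality => k; rewrite /ssub subr0.
Qed.

Lemma act_sumr (I : Type) (l : seq I) f (h : I -> M) : tate f ->
  act f (\sum_(i <- l) h i) = \sum_(i <- l) act f (h i).
Proof.
move=> tf; elim: l => [|a l IH]; first by rewrite !big_nil act0r.
by rewrite !big_cons act_addr // IH.
Qed.

Lemma act_suml (I : Type) (l : seq I) (q : I -> series) m : (forall i, tate (q i)) ->
  act (fun k => \sum_(i <- l) q i k) m = \sum_(i <- l) act (q i) m.
Proof.
move=> tq; suff : tate (fun k => \sum_(i <- l) q i k) /\
  act (fun k => \sum_(i <- l) q i k) m = \sum_(i <- l) act (q i) m by case.
elim: l => [|a l [IH1 IH2]].
  have -> : (fun k => \sum_(i <- [::]) q i k) = (fun=> 0).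
    by apply: functional_extensionality => k; rewrite big_nil.
  by rewrite big_nil act0l; split=> //; exact: tate0.
have -> : (fun k => \sum_(i <- a :: l) q i k) =
          sadd (q a) (fun k => \sum_(i <- l) q i k).
  by apply: functional_extensionality => k; rewrite big_cons.
by rewrite big_cons act_addl // IH2; split=> //; exact: tate_add.
Qed.

Lemma actC f g m : tate f -> tate g -> act f (act g m) = act g (act f m).
Proof. by move=> tf tg; rewrite -!act_mull // smulC. Qed.

Lemma tate_zminus c : tate (zm c).
Proof.
apply: (@tate_finsupp _ _ _ _ _ (deg (zidx d) + deg (mi0 d.+1)).+1) => k; rewrite /zminus.
case: eqP => [->|_]; first by rewrite ltnNge leq_addr.
by case: eqP => [->|//]; rewrite ltnNge leq_addl.
Qed.

Lemma zminusD c x m : act (zm (c + x)) m = act (zm c) m - act (cst x) m.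
Proof.
rewrite -act_subl; [|exact: tate_zminus|exact: tate_cst].
congr Defs.act; apply: functional_extensionality => k; rewrite /zminus /ssub /cst /mono.
case: eqP => [->|_]; last by case: eqP => _; rewrite ?opprD ?subr0.
case: eqP => [e|_]; last by rewrite subr0.
by have := congr1 (fun u : mi d.+1 => u ord_max) e; rewrite !ffunE eqxx.
Qed.

Lemma cstK x m : x <> 0 -> act (cst x) (act (cst x^-1) m) = m.
Proof.
move=> /eqP x0; rewrite -act_mull; try exact: tate_cst.
rewrite -[RHS](act_one A); congr Defs.act; apply: functional_extensionality => k.
rewrite smul_mono mi_le0 mi_sub0 /cst /mono /sone.
by case: eqP => _; rewrite ?mulfV ?mulr0.
Qed.

Definition submod (P : M -> Prop) := P 0 /\ (forall m m', P m -> P m' -> P (m - m')) /\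
  forall f m, tate f -> P m -> P (act f m).

Lemma submodD P m m' : submod P -> P m -> P m' -> P (m + m').
Proof.
move=> [P0 [PB _]] Pm Pm'; rewrite -[m']opprK; apply: (PB) => //.
by rewrite -sub0r; exact: PB.
Qed.

Lemma submod_sum P (I : Type) (l : seq I) (h : I -> M) : submod P ->
  (forall i, P (h i)) -> P (\sum_(i <- l) h i).
Proof.
move=> sP Ph; elim: l => [|a l IH]; first by rewrite big_nil; case: sP.
by rewrite big_cons; apply: submodD.
Qed.

Lemma submod0 : submod (fun m => m = 0).
Proof.
split=> //; split=> [m m' -> ->|f m tf ->]; first by rewrite subr0.
exact: act0r.
Qed.

(** The subset gM + P; that it contains every [m] means that [g] acts surjectively on M/P. *)
Definition img_mod g (P : M -> Prop) m := exists h, P (m - act g h).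

Lemma submod_img g P : tate g -> submod P -> submod (img_mod g P).
Proof.
move=> tg sP; case: (sP) => [P0 [PB PZ]]; split.
  by exists 0; rewrite act0r // subr0.
split=> [m m' [h Ph] [h' Ph']|f m tf [h Ph]].
  exists (h - h'); rewrite act_subr //.
  have -> : m - m' - (act g h - act g h') = (m - act g h) - (m' - act g h').
    by rewrite !opprD !opprK addrACA.
  exact: PB.
by exists (act f h); rewrite actC // -act_subr //; exact: PZ.
Qed.

(** * Residue norm and bounded generation *)

Variables (r : nat) (e : 'I_r -> M).
Hypothesis gen : forall m, exists f : 'I_r -> series,
  (forall i, tate (f i)) /\ m = \sum_(i < r) act (f i) (e i).

Local Notation vec := (vec K d.+1 r).
Definition lin (F : vec) : M := \sum_i act (F i) (e i).

(** Bound for the residue norm of M as a quotient of T^r through [lin], expressed by a lift so that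
    no infimum is taken. *)
Definition msz m B := exists F : vec, [/\ vtate V F, vle V F B & m = lin F].

Lemma lin_sub (F G : vec) : vtate V F -> vtate V G -> lin (vsub F G) = lin F - lin G.
Proof. by move=> tF tG; rewrite /lin -sumrB; apply: eq_bigr => i _; rewrite act_subl. Qed.

Lemma lin_smul q (F : vec) : tate q -> vtate V F -> lin (vsmul q F) = act q (lin F).
Proof.
by move=> tq tF; rewrite /lin act_sumr //; apply: eq_bigr => i _; rewrite act_mull.
Qed.

Lemma lin_comb s (q : 'I_s -> series) (f : 'I_s -> vec) :
  (forall t, tate (q t)) -> (forall t, vtate V (f t)) ->
  lin (comb q f) = \sum_t act (q t) (lin (f t)).
Proof.
move=> tq tf; transitivity (\sum_t \sum_i act (q t) (act (f t i) (e i))).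
  rewrite exchange_big; apply: eq_bigr => i _ /=.
  rewrite act_suml => [|t]; last by apply: tate_smul => //; exact: tf.
  by apply: eq_bigr => t _; rewrite act_mull //; exact: tf.
by apply: eq_bigr => t _; rewrite act_sumr.
Qed.


Lemma msz_ex m : exists B, (0 < B)%Re /\ msz m B.
Proof.
have [F [tF ->]] := gen m; have [B HB] := choice_fun (fun i => tate_bounded (tF i)).
have [C [C0 HC]] := list_bound B (enum 'I_r); exists C; split=> //; exists F.
split=> // -[i k]; apply: Rle_trans (HC i _); last by rewrite mem_enum.
exact: (HB i).2.
Qed.

Lemma msz_le m B C : (B <= C)%Re -> msz m B -> msz m C.
Proof. by move=> BC [F [tF FB mF]]; exists F; split=> //; exact: vle_trans BC FB. Qed.

Lemma msz_sub m m' B : msz m B -> msz m' B -> msz (m - m') B.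
Proof.
move=> [F [tF FB ->]] [G [tG GB ->]]; exists (vsub F G); rewrite lin_sub //; split=> //.
  exact: vtate_sub.
exact: vle_sub.
Qed.

Lemma msz0 B : (0 < B)%Re -> msz 0 B.
Proof.
move=> B0; exists (fun _ _ => 0); split.
- by move=> i; exact: tate0.
- by move=> x; rewrite /at_ abs0; lra.
- by rewrite /lin big1 // => i _; rewrite act0l.
Qed.

Lemma mszD m m' B : (0 < B)%Re -> msz m B -> msz m' B -> msz (m + m') B.
Proof.
move=> B0 mB mB'; have -> : m + m' = m - (0 - m') by rewrite sub0r opprK.
apply: msz_sub => //.
by apply: msz_sub => //; exact: msz0.
Qed.

Lemma msz_act q m B C : tate q -> nle q B -> msz m C -> msz (act q m) (B * C).
Proof.
move=> tq qB [F [tF FC ->]]; exists (vsmul q F); rewrite lin_smul //; split=> //.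
  by move=> i; exact: tate_smul.
by move=> x; apply: nle_smul => // k; exact: (FC (x.1, k)).
Qed.

Lemma msz_sum s (h : 'I_s -> M) B : (0 < B)%Re -> (forall i, msz (h i) B) ->
  msz (\sum_i h i) B.
Proof.
move=> B0 hB; apply: (big_ind (fun m => msz m B)) => //; first exact: msz0.
by move=> m m'; exact: mszD.
Qed.

Lemma msz_family s (h : 'I_s -> M) : exists C, (0 < C)%Re /\ forall i, msz (h i) C.
Proof.
have [B HB] := choice_fun (fun i => msz_ex (h i)).
have [C [C0 HC]] := list_bound B (enum 'I_s); exists C; split=> // i.
by apply: msz_le (HB i).2; apply: HC; rewrite mem_enum.
Qed.

(** [division] is applied to the preimage of [P] under [lin]. The last hypothesis on [m] places it
    in the closure of [P]. *)
Theorem submod_bounded_gens P : submod P -> exists s (g : 'I_s -> M), (forall i, P (g i)) /\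
  forall m B, (0 < B)%Re -> msz m B ->
  (forall eps, (0 < eps)%Re -> exists u, msz u eps /\ P (m - u)) ->
  exists q : 'I_s -> series,
    [/\ forall t, tate (q t), forall t, nle (q t) B & m = \sum_t act (q t) (g t)].
Proof.
move=> [P0 [PB PZ]]; pose N (F : vec) := vtate V F /\ P (lin F).
have [//|F G [tF PF] [tG PG]|q F tq [tF PF]||s [f [Nf Hf]]] := @division _ _ V d.+1 r N.
- by move=> F [].
- by split; [exact: vtate_sub|rewrite lin_sub //; exact: PB].
- split; last by rewrite lin_smul //; exact: PZ.
  by move=> i; exact: tate_smul.
- split; first by move=> i; exact: tate0.
  by rewrite /lin big1 // => i _; rewrite act0l.
exists s, (fun t => lin (f t)); split; first by move=> t; exact: (Nf t).2.
move=> m B B0 [F [tF FB ->]] cl.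
have [|q [tq qB ->]] := Hf B F B0 tF FB.
  move=> eps /cl[u [[U [tU UB ->]] PU]]; exists (vsub F U); split.
    by split; [exact: vtate_sub|rewrite lin_sub].
  move=> x; have := UB x; congr (Rle (abs _) _).
  by rewrite /at_ /vsub /ssub opprB addrC subrK.
by exists q; split=> //; apply: lin_comb => // t; exact: (Nf t).1.
Qed.

(* Bounded generation makes every submodule closed, so halving the error suffices. *)
Lemma submod_full P : submod P ->
  (forall m B, (0 < B)%Re -> msz m B -> exists u, msz u (B / 2) /\ P (m - u)) ->
  forall m, P m.
Proof.
move=> sP half m; have [s [g [Pg Hg]]] := submod_bounded_gens sP.
have [B [B0 mB]] := msz_ex m.
have h2 j : (0 < (/2) ^ j * B)%Re.
  by apply: Rmult_lt_0_compat => //; apply: pow_lt; lra.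
have it j : exists u, msz u ((/2) ^ j * B) /\ P (m - u).
  elim: j => [|j [u [uB Pu]]].
    by exists m; rewrite subrr /= Rmult_1_l; split=> //; case: sP.
  have [v [vB Pv]] := half u _ (h2 j) uB.
  exists v; split; first by apply: msz_le vB => /=; lra.
  by rewrite -(subrKA u); apply: submodD.
have [|q [tq _ ->]] := Hg m B B0 mB.
  move=> eps e0; have [J HJ] := pow_small (ltac:(lra) : (0 < /2 < 1)%Re) e0 (Rlt_le _ _ B0).
  have [u [uB Pu]] := it J; exists u; split=> //.
  by apply: msz_le uB; apply: Rlt_le; exact: HJ.
by apply: submod_sum => // t; case: sP => _ [_]; apply.
Qed.

(** * Perturbation of the point c *)

Lemma msz_cst x m B C : (abs x * C <= /2)%Re -> (0 < B)%Re ->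
  msz m (B * C) -> msz (act (cst x) m) (B / 2).
Proof.
move=> xC B0 mB; apply: (@msz_le _ (abs x * (B * C))%Re); first by nra.
by apply: msz_act => //; [exact: tate_cst|apply: nle_mono; lra].
Qed.

Lemma half_radius C : (0 < C)%Re -> exists eta, (0 < eta)%Re /\
  forall x, (abs x < eta)%Re -> (abs x * C <= /2)%Re.
Proof.
move=> C0; exists (/ 2 / C)%Re; split; first by apply: Rdiv_lt_0_compat; lra.
move=> x hx; have -> : (/2 = /2 / C * C)%Re by field; lra.
by apply: Rmult_le_compat_r; lra.
Qed.

(** Write each generator as (z-c) [h i] modulo [P]. For m = sum of [F i] [e i], the element w = sum
    of [F i] [h i] solves (z-c)w = m modulo [P], so m differs from (z-c-x)w by xw modulo [P]. For
    small x this error has at most half the size of m, and [submod_full] applies. *)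
Lemma img_full_open c P : submod P -> (forall m, img_mod (zm c) P m) ->
  exists eta, (0 < eta)%Re /\
  forall x, (abs x < eta)%Re -> forall m, img_mod (zm (c + x)) P m.
Proof.
move=> sP full; have [h Hh] := choice_fun (fun i => full (e i)).
have [C [C0 hC]] := msz_family h; have [eta [eta0 Heta]] := half_radius C0.
exists eta; split=> // x /Heta xC; have tz := tate_zminus.
apply: submod_full; first exact: submod_img.
move=> m B B0 [F [tF FB ->]]; pose w := \sum_i act (F i) (h i).
exists (act (cst x) w); split.
  apply: (msz_cst xC B0); apply: msz_sum; first by apply: Rmult_lt_0_compat.
  by move=> i; apply: msz_act => // k; exact: (FB (i, k)).
exists w; rewrite zminusD opprB addrA subrK.
rewrite /w act_sumr // /lin -sumrB; apply: submod_sum => // i.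
by rewrite actC // -act_subr //; case: sP => _ [_]; apply.
Qed.

Definition tors c m := exists k, iter k (act (zm c)) m = 0.

Lemma submod_tors c : submod (tors c).
Proof.
have tz := tate_zminus c; pose y := act (zm c).
have y0 k : iter k y 0 = 0 by elim: k => //= k ->; exact: act0r.
split; first by exists 0%N.
split=> [m m' [k Hk] [k' Hk']|f m tf [k Hk]].
  have yB j : iter j y (m - m') = iter j y m - iter j y m'.
    by elim: j => //= j ->; rewrite /y act_subr.
  exists (k + k')%N; rewrite -/y yB {1}addnC !iterD.
  by rewrite /y in y0 *; rewrite Hk Hk' !y0 subrr.
exists k; have -> : iter k (act (zm c)) (act f m) = act f (iter k (act (zm c)) m).
  by elim: {Hk} k => //= k ->; rewrite actC.
by rewrite Hk act0r.
Qed.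

Lemma tors_act c m : tors c (act (zm c) m) -> tors c m.
Proof. by move=> [k Hk]; exists k.+1; rewrite iterSr. Qed.

(** On torsion y = z-c is locally nilpotent and x is invertible. By induction on the exponent ym =
    (y-x)m1, whence xm = ym - (y-x)m = (y-x)(m1 - m), and x can be divided out. *)
Lemma tors_divisible c x m : x <> 0 -> tors c m -> exists m', m = act (zm (c + x)) m'.
Proof.
move=> x0 [k]; have tz := tate_zminus; have tc := tate_cst V d.+1.
elim: k m => [|k IH] m /=; first by move=> ->; exists 0; rewrite act0r.
rewrite -iterS iterSr => /IH[m1 ym].
have xm : act (cst x) m = act (zm (c + x)) (m1 - m).
  by rewrite act_subr // -ym zminusD opprB addrC subrK.
exists (act (cst x^-1) (m1 - m)).
by rewrite actC // -xm actC // cstK.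
Qed.

Lemma vanishes_mod_tors c x : x <> 0 ->
  vanishes_at A (c + x) <-> forall m, img_mod (zm (c + x)) (tors c) m.
Proof.
move=> x0; split=> [van m|full m].
  have [h ->] := van m; exists h; rewrite subrr; exact: (submod_tors c).1.
have [h /(tors_divisible x0)[h' mh]] := full m.
exists (h' + h); rewrite act_addr; last exact: tate_zminus.
by rewrite -mh subrK.
Qed.

(** Bounded division by z-c modulo torsion. Bounded generation of (z-c)M + tors writes [w] with
    controlled coefficients in generators [g t], each equal to (z-c) [h t] modulo torsion; the same
    combination of the [h t] is the lift. It agrees with [n] modulo torsion because z-c is injective
    on M/tors. *)
Lemma lift_bounded c : exists C, (0 < C)%Re /\ forall w B n, (0 < B)%Re -> msz w B ->
  tors c (w - act (zm c) n) -> exists h, msz h (B * C) /\ tors c (h - n).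
Proof.
have tz := tate_zminus c; have sT := submod_tors c.
have [s [g [Qg Hg]]] := submod_bounded_gens (submod_img tz sT).
have [h Hh] := choice_fun Qg; have [C [C0 hC]] := msz_family h.
exists C; split=> // w B n B0 wB wn.
have [eps e0|q [tq qB wq]] := Hg w B B0 wB.
  by exists 0; split; [exact: msz0|rewrite subr0; exists n].
exists (\sum_t act (q t) (h t)); split.
  by apply: msz_sum => [|t]; [exact: Rmult_lt_0_compat|exact: msz_act].
apply: tors_act; rewrite act_subr // -(subrKA w); apply: submodD => //.
rewrite -opprB -sub0r; apply: (sT.2.1) => //; first exact: sT.1.
rewrite wq act_sumr // -sumrB; apply: submod_sum => // t.
by rewrite actC // -act_subr //; apply: sT.2.2.
Qed.

(** Surjectivity at c+x gives n with (z-c)n = m + xn modulo torsion, but n has uncontrolled size.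
    [lift_bounded] replaces n by an h of size at most BC in the same class modulo torsion; then m +
    xh lies in (z-c)M + tors and xh has at most half the size of m. *)
Lemma img_full_descend c : exists eta, (0 < eta)%Re /\ forall x, (abs x < eta)%Re ->
  (forall m, img_mod (zm (c + x)) (tors c) m) -> forall m, img_mod (zm c) (tors c) m.
Proof.
have tz := tate_zminus; have sT := submod_tors c.
have [C [C0 lift]] := lift_bounded c; have [eta [eta0 Heta]] := half_radius C0.
exists eta; split=> // x /Heta xC full; apply: submod_full; first exact: submod_img.
move=> m B B0 mB; have [n mn] := full m; have [D [D0 nD]] := msz_ex n.
have BC0 : (0 < B * C)%Re by exact: Rmult_lt_0_compat.
have yn h : tors c (h - n) -> tors c (m + act (cst x) h - act (zm c) n).
  move=> hn; have := submodD sT mn (sT.2.2 _ _ (tate_cst V d.+1 x) hn).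
  rewrite act_subr ?zminusD; last exact: tate_cst.
  by rewrite opprB addrACA (addrAC (act (cst x) n)) subrr sub0r.
(* Each round lifts m + xh afresh. As [abs x * C <= /2], the term coming from h is halved, while the
   one coming from m stays at most [B * C]. *)
have it j : exists h, msz h (Rmax (B * C) ((/2) ^ j * D)) /\ tors c (h - n).
  elim: j => [|j [h [hD hn]]].
    exists n; split; last by rewrite subrr; exact: sT.1.
    by apply: msz_le nD; rewrite /= Rmult_1_l; exact: Rmax_r.
  set Dj := Rmax _ _ in hD.
  have Bx0 : (0 < Rmax B (abs x * Dj))%Re by apply: Rlt_le_trans B0 (Rmax_l _ _).
  have [|h' [h'B h'n]] := lift _ _ n Bx0 _ (yn h hn).
    apply: mszD => //; first exact: msz_le (Rmax_l _ _) mB.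
    apply: msz_le (Rmax_r _ _) _; apply: msz_act hD; first exact: tate_cst.
    exact: nle_mono (Rle_refl _).
  exists h'; split=> //; apply: msz_le h'B.
  have := Rmax_l (B * C) ((/2) ^ j.+1 * D); have := Rmax_r (B * C) ((/2) ^ j.+1 * D).
  have -> : ((/2) ^ j.+1 * D = (/2) ^ j * D / 2)%Re by rewrite /=; lra.
  have : (abs x * Dj * C <= Dj * /2)%Re.
    have Dj0 : (0 <= Dj)%Re by apply: Rle_trans (Rlt_le _ _ BC0) (Rmax_l _ _).
    by nra.
  have : Dj = (B * C)%Re \/ Dj = ((/2) ^ j * D)%Re.
    by rewrite /Dj /Rmax; case: Rle_dec; auto.
  have : Rmax B (abs x * Dj) = B \/ Rmax B (abs x * Dj) = (abs x * Dj)%Re.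
    by rewrite /Rmax; case: Rle_dec; auto.
  by move=> [->|->] [->|->]; lra.
have [J HJ] := pow_small (ltac:(lra) : (0 < /2 < 1)%Re) BC0 (Rlt_le _ _ D0).
have [h [hB hn]] := it J.
have {}hB : msz h (B * C).
  by apply: msz_le hB; apply: Rmax_lub; [lra|apply/Rlt_le/HJ].
exists (- act (cst x) h); split.
  rewrite -sub0r; apply: msz_sub; first by apply: msz0; lra.
  exact: msz_cst xC B0 hB.
exists h; rewrite opprK.
have -> : m + act (cst x) h - act (zm c) h =
    (m + act (cst x) h - act (zm c) n) - act (zm c) (h - n).
  by rewrite act_subr // opprB addrA subrK.
by apply: sT.2.1; [exact: yn|exact: sT.2.2].
Qed.

(** Surjectivity of z-c on M/tors decides which alternative holds. The centre is excluded because
    division on the torsion requires a nonzero displacement from c. *)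
Lemma vanishing_dichotomy c : exists eta, (0 < eta)%Re /\
  ((forall x, x <> c -> (abs (x - c) < eta)%Re -> vanishes_at A x) \/
   (forall x, x <> c -> (abs (x - c) < eta)%Re -> ~ vanishes_at A x)).
Proof.
have cx x : x <> c -> x - c <> 0 by move=> xc /eqP; rewrite subr_eq0 => /eqP.
case: (classic (forall m, img_mod (zm c) (tors c) m)) => full.
  have [eta [eta0 H]] := img_full_open (submod_tors c) full.
  exists eta; split=> //; left=> x /cx xc /H h.
  rewrite -(subrKC c x).
  by apply/vanishes_mod_tors.
have [eta [eta0 H]] := img_full_descend c.
exists eta; split=> //; right=> x /cx xc /H h.
by rewrite -(subrKC c x) => /(vanishes_mod_tors _ xc) /h.
Qed.

(** [img_full_open] with the zero submodule in place of the torsion, so that the centre is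
    included. *)
Lemma vanishing_open c : vanishes_at A c -> exists eta, (0 < eta)%Re /\
  forall x, (abs (x - c) < eta)%Re -> vanishes_at A x.
Proof.
move=> van; have [m|eta [eta0 H]] := @img_full_open c _ submod0.
  by have [h ->] := van m; exists h; rewrite subrr.
exists eta; split=> // x /H h m; rewrite -(subrKC c x).
by have [m' /eqP] := h m; rewrite subr_eq0 => /eqP ->; exists m'.
Qed.

End Modules.

(** * Membership and selection in finite sequences *)

Lemma In_mem (T : eqType) (x : T) (s : seq T) : List.In x s <-> x \in s.
Proof.
elim: s => //= a s IH; rewrite inE IH; split=> [[->|->]|/orP[/eqP->|]]; auto.
- by rewrite eqxx.
- by rewrite orbT.
Qed.

Lemma seq_sep (T : eqType) (Q : T -> Prop) (s : seq T) :
  exists s' : seq T, forall x, x \in s' <-> x \in s /\ Q x.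
Proof.
elim: s => [|a s [s' Hs']]; first by exists [::] => x; split=> // -[].
case: (classic (Q a)) => Qa.
  exists (a :: s') => x; rewrite !inE; split.
    by move=> /orP[/eqP->|/Hs'[xs Qx]]; rewrite ?eqxx // xs orbT.
  by move=> [/orP[->//|xs] Qx]; apply/orP; right; apply/Hs'.
exists s' => x; rewrite inE; split; first by move=> /Hs'[-> Qx]; rewrite orbT.
by move=> [/orP[/eqP->//|xs] Qx]; apply/Hs'.
Qed.

(** * Integers in K *)

Section Integers.
Variables (p : nat) (p_prime : prime p) (K : fieldType) (V : NAField p K).
Local Notation abs := (nabs V).

Lemma inv_p_bounds : (0 < / INR p < 1)%Re.
Proof.
have h : (1 < INR p)%Re.
  by rewrite -INR_1; apply: lt_INR; apply/ssrnat.ltP; exact: prime_gt1.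
split; first by apply: Rinv_0_lt_compat; lra.
by rewrite -Rinv_1; apply: Rinv_lt_contravar; lra.
Qed.

Lemma abs_int_le1 (z : int) : (abs z%:~R <= 1)%Re.
Proof.
have hn (n : nat) : (abs n%:R <= 1)%Re.
  elim: n => [|n IH]; first by rewrite abs0; lra.
  by rewrite -natr1; apply: abs_add_le => //; rewrite abs1; lra.
by case: z => n; [exact: hn|rewrite NegzE mulrNz absN; exact: hn].
Qed.

Lemma abs_p_expn r : abs ((p ^ r)%:R) = ((/ INR p) ^ r)%Re.
Proof.
elim: r => [|r IH]; first by rewrite expn0 abs1.
by rewrite expnS natrM nabs_mul nabs_p IH.
Qed.

Lemma abs_dvd_le r (z : int) : ((p ^ r)%:Z %| z)%Z -> (abs z%:~R <= (/ INR p) ^ r)%Re.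
Proof.
move=> /dvdzP[t ->]; rewrite intrM -(Rmult_1_l (_ ^ r)).
apply: abs_mul_le; first exact: abs_int_le1.
by rewrite -abs_p_expn; exact: Rle_refl.
Qed.

(** Factors p are nonzero since |p| = 1/p. For m prime to p, a Bezout relation um = vp + 1 with m =
    0 in K would give -1 = vp, of absolute value below 1. *)
Lemma natr_neq0 (m : nat) : (0 < m)%N -> (m%:R : K) != 0.
Proof.
have pb := inv_p_bounds.
elim/ltn_ind: m => m IH m0; case: (boolP (p %| m)%N) => [/dvdnP[t mt]|pm].
  have t0 : (0 < t)%N by move: m0; rewrite mt muln_gt0 => /andP[].
  rewrite mt natrM mulf_neq0 //.
    apply: IH => //; rewrite mt -{1}(muln1 t) ltn_mul2l t0; exact: prime_gt1.
  by apply/eqP => /(nabs_eq0 V); rewrite nabs_p; lra.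
have : coprime m p by rewrite coprime_sym prime_coprime.
move=> /(coprimeP _ m0)[[u v] /= uv]; apply/eqP => m00.
have e : (u * m = v * p + 1)%N.
  by rewrite -uv subnKC // ltnW // -subn_gt0 uv.
have := congr1 (fun k : nat => k%:R : K) e; rewrite natrD !natrM m00 mulr0 => e'.
have : abs (- 1) = abs (v%:R * p%:R).
  by congr abs; apply/eqP; rewrite -subr_eq0 -opprD oppr_eq0 addrC -e'.
rewrite absN abs1 nabs_mul nabs_p; have := abs_int_le1 v.
rewrite -pmulrn => v1 e1.
have : (abs v%:R * / INR p <= 1 * / INR p)%Re by apply: Rmult_le_compat_r => //; lra.
by rewrite -e1; lra.
Qed.

Lemma intr_inj_K : injective (fun z : int => z%:~R : K).
Proof.
move=> z t /eqP; rewrite -subr_eq0 -intrB => h; apply/eqP; rewrite -subr_eq0.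
move: h; case: (z - t) => n /=.
  by case: n => // n; rewrite -pmulrn => h; have := natr_neq0 (ltn0Sn n); rewrite h.
by rewrite NegzE mulrNz oppr_eq0 -pmulrn => h; have := natr_neq0 (ltn0Sn n); rewrite h.
Qed.

(** One implication suffices, the conditions on [m] and [m'] being symmetric. *)
Definition locally_periodic (W : int -> Prop) (r : nat) (a : int) :=
  exists (s : nat) (l : seq int), forall m m' : int,
    ((p ^ r)%:Z %| m - a)%Z -> ((p ^ r)%:Z %| m' - a)%Z -> ((p ^ s)%:Z %| m - m')%Z ->
    m \notin l -> m' \notin l -> W m -> W m'.

Lemma dvd_pexp (a b : nat) (z : int) : (a <= b)%N ->
  ((p ^ b)%:Z %| z)%Z -> ((p ^ a)%:Z %| z)%Z.
Proof. by move=> ab; apply: dvdz_trans; rewrite dvdzE dvdn_exp2l. Qed.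

(** A class modulo p^r splits into p classes modulo p^(r+1), so finitely many periods and
    exceptional lists are merged. *)
Lemma locally_periodic_split W r a :
  (forall b, ((p ^ r)%:Z %| b - a)%Z -> locally_periodic W r.+1 b) -> locally_periodic W r a.
Proof.
move=> H; pose b (i : 'I_p) : int := a + (p ^ r)%:Z * i%:Z.
have Hb i : ((p ^ r)%:Z %| b i - a)%Z by rewrite /b addrC addKr dvdz_mulr.
have [s Hs] := choice_fun (fun i => H _ (Hb i)); have [l Hl] := choice_fun Hs.
(* The term [r.+1] forces [m] and [m'] into the same child class. *)
exists (maxn r.+1 (\max_i s i)), (flatten [seq l i | i <- enum 'I_p]).
move=> m m' /dvdzP[t mt] m'a mm' ml m'l.
have p0 : (p%:Z : int) != 0 by rewrite -lt0n prime_gt0.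
have tb := modz_ge0 t p0; have tb' : (t %% p)%Z < p%:Z.
  by apply: ltz_pmod; rewrite ltz_nat prime_gt0.
have [i ti] : exists i : 'I_p, i%:Z = (t %% p)%Z.
  case: (t %% p)%Z tb tb' => // k _; rewrite ltz_nat => kp.
  by exists (Ordinal kp).
have mb : ((p ^ r.+1)%:Z %| m - b i)%Z.
  have -> : m - b i = (t %/ p)%Z * (p ^ r.+1)%:Z.
    rewrite /b opprD addrA mt {1}(divz_eq t p) -ti expnSr PoszM mulrDl.
    by rewrite (mulrC i%:Z) addrK -mulrA (mulrC p%:Z).
  exact: dvdz_mull.
have lE k : k \notin flatten [seq l i | i <- enum 'I_p] -> k \notin l i.
  apply: contra => kl; apply/flattenP; exists (l i) => //.
  by apply: map_f; rewrite mem_enum.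
apply: (Hl i) => //; try exact: lE.
- have -> : m' - b i = (m - b i) - (m - m') by rewrite opprB [RHS]addrC subrKA.
  by rewrite rpredB //; apply: dvd_pexp mm'; exact: leq_maxl.
- apply: dvd_pexp mm'; apply: leq_trans (leq_maxr _ _); exact: (leq_bigmax i).
Qed.

(** If the root class were bad, every bad class would have a bad child, giving an infinite branch
    [u] that is Cauchy in K. Near its limit c, which need not be an integer, [W] is constant off c,
    so a deep enough class on the branch is periodic, a contradiction. *)
Lemma locally_periodic_global (W : int -> Prop) :
  (forall c : K, exists eta, (0 < eta)%Re /\
    ((forall m, m%:~R <> c -> (abs (m%:~R - c) < eta)%Re -> W m) \/
     (forall m, m%:~R <> c -> (abs (m%:~R - c) < eta)%Re -> ~ W m))) ->
  locally_periodic W 0 0.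
Proof.
move=> loc; apply: NNPP => bad; have pb := inv_p_bounds.
pose nxt (x : nat * int) (b : int) := ~ locally_periodic W x.1 x.2 ->
  ((p ^ x.1)%:Z %| b - x.2)%Z /\ ~ locally_periodic W x.1.+1 b.
have [step Hstep] : exists step, forall x, nxt x (step x).
  apply: choice_fun => -[r a]; rewrite /nxt /=.
  case: (classic (locally_periodic W r a)) => [h|nh]; first by exists 0.
  apply: NNPP => no; apply: nh; apply: locally_periodic_split => b ba.
  by apply: NNPP => nb; apply: no; exists b.
pose u := fix u r : int := if r is r'.+1 then step (r', u r') else 0.
have ubad r : ~ locally_periodic W r (u r).
  by elim: r => // r IH; have [] := Hstep (r, u r) IH.
have ustep r : ((p ^ r)%:Z %| u r.+1 - u r)%Z.
  by have [] := Hstep (r, u r) (ubad r).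
have ucau J i : ((p ^ J)%:Z %| u (J + i)%N - u J)%Z.
  elim: i => [|i IH]; first by rewrite addn0 subrr dvdz0.
  rewrite -(subrKA (u (J + i)%N)) rpredD // addnS.
  by apply: dvd_pexp (ustep _); exact: leq_addr.
have pow_lt eps : (0 < eps)%Re -> exists J, forall j, (J <= j)%N -> ((/ INR p) ^ j < eps)%Re.
  move=> e0; have [J HJ] := pow_small pb e0 (Rle_0_1); exists J => j /HJ.
  by rewrite Rmult_1_r.
have [|c Hc] := @nabs_complete p K V (fun r => (u r)%:~R).
  move=> eps /pow_lt[J HJ]; exists J => a b Ja Jb.
  apply: Rle_lt_trans (HJ J (leqnn _)).
  rewrite -intrB; apply: abs_dvd_le; rewrite -(subrKA (u J)) rpredD //.
    by rewrite -(subnKC Ja).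
  by rewrite -opprB rpredN -(subnKC Jb).
have [eta [eta0 Heta]] := loc c.
have [N HN] := Hc eta eta0; have [N' HN'] := pow_lt eta eta0.
pose J := (N + N')%N.
have near m : ((p ^ J)%:Z %| m - u J)%Z -> (abs (m%:~R - c) < eta)%Re.
  move=> mu; rewrite -(subrKA (u J)%:~R); apply: abs_add_lt; last exact: HN (leq_addr _ _).
  rewrite -intrB; apply: Rle_lt_trans (HN' J (leq_addl _ _)); exact: abs_dvd_le.
(* At most one integer equals c in K, by injectivity of the integers in K. *)
have [l Hl] : exists l : seq int, forall m, m \notin l -> m%:~R <> c.
  case: (classic (exists m0 : int, m0%:~R = c)) => [[m0 m0c]|no].
    exists [:: m0] => m; rewrite inE => /eqP mm0; rewrite -m0c => /intr_inj_K; exact: mm0.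
  by exists [::] => m _ mc; apply: no; exists m.
apply: (ubad J); exists 0%N, l => m m' /near mn /near m'n _ /Hl mc /Hl m'c.
by case: Heta => h Wm; [exact: h|case: (h m mc mn)].
Qed.

Lemma periodic_progressions (W : int -> Prop) : locally_periodic W 0 0 ->
  exists (r : nat) (res l : seq int), forall m : int, ~ List.In m l ->
    (W m <-> exists2 a, List.In a res & (m = a %[mod (p ^ r)%:Z])%Z).
Proof.
move=> [r [l H]]; have pr0 : (0 < p ^ r)%N by rewrite expn_gt0 prime_gt0.
have {}H m m' : (m = m' %[mod (p ^ r)%:Z])%Z -> m \notin l -> m' \notin l -> W m -> W m'.
  move=> /eqP; rewrite eqz_mod_dvd => mm'; apply: H => //; exact: dvd1z.
(* A residue is kept when some non-exceptional member of its class satisfies [W]; the residue itself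
   may belong to [l]. *)
have [res Hres] := seq_sep
  (fun a => exists m, [/\ m \notin l, W m & (m = a %[mod (p ^ r)%:Z])%Z])
  [seq Posz i | i <- iota 0 (p ^ r)].
exists r, res, l => m /In_mem/negP ml; split=> [Wm|[a /In_mem/Hres[_ [m' [m'l Wm' m'a]]] ma]].
  exists (m %% (p ^ r)%:Z)%Z; last by rewrite modz_mod.
  apply/In_mem/Hres; split; last by exists m; rewrite modz_mod.
  have q0 : (p ^ r)%:Z != 0 by rewrite -lt0n.
  have: (0 <= m %% (p ^ r)%:Z < (p ^ r)%:Z)%Z.
    by rewrite modz_ge0 //= ltz_pmod // ltz_nat.
  case: (m %% (p ^ r)%:Z)%Z => // k; rewrite ltz_nat => /andP[_ kp].
  by apply: map_f; rewrite mem_iota.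
by apply: (H m') => //; rewrite m'a ma.
Qed.

End Integers.

Theorem theoremA1 (p : nat) (p_prime : prime p) (K : fieldType)
    (V : NAField p K) (d : nat) (M : zmodType) (A : TateModule (nabs V) d M)
    (fgA : fin_gen A) :
  (* (1) the vanishing locus is open in any subring S of o *)
  (forall S : K -> Prop, subring_of_o (nabs V) S ->
     open_in (nabs V) S (fun c => S c /\ vanishes_at A c)) /\
  (* (2) if S is compact: up to finite sets, a union of balls of radius eps *)
  (forall S : K -> Prop, subring_of_o (nabs V) S -> compact_in (nabs V) S ->
     exists eps : R, Rlt R0 eps /\
       exists (C : K -> Prop) (l : seq K),
         (forall a, C a -> S a) /\
         (forall c, S c -> ~ List.In c l ->
            (vanishes_at A c <->
             exists a, C a /\ Rle (nabs V (c - a)) eps))) /\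
  (* (3) S = Z: up to finite sets, a finite union of arithmetic progressions
         with difference p^r *)
  (exists (r : nat) (res : seq int) (l : seq int),
     forall m : int, ~ List.In m l ->
       (vanishes_at A (m%:~R : K) <->
        exists2 a, List.In a res & (m = a %[mod (p ^ r)%:Z])%Z)).
Proof.
have [r [e gen]] := fgA; split; [|split].
- move=> S _ c _ [Sc van]; have [eta [eta0 H]] := vanishing_open gen van.
  by exists eta; split=> // c' Sc' /H.
- move=> S _ comp.
  (* The cover is indexed by all balls, given by centre and radius, on which the dichotomy holds. *)
  pose good (q : K * R) := (0 < q.2)%Re /\
    ((forall x, x <> q.1 -> (nabs V (x - q.1) < q.2)%Re -> vanishes_at A x) \/
     (forall x, x <> q.1 -> (nabs V (x - q.1) < q.2)%Re -> ~ vanishes_at A x)).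
  pose U (i : {q | good q}) c := (nabs V (c - (sval i).1) < (sval i).2)%Re.
  have [|c _|l Hl] := comp {q | good q} U.
  + move=> i c _ Uc; exists (sval i).2; split=> [|c' _ c'c]; first by case: (svalP i).
    by rewrite /U -(subrKA c); exact: abs_add_lt.
  + have [eta [eta0 H]] := vanishing_dichotomy gen c.
    exists (exist _ (c, eta) (conj eta0 H)).
    by rewrite /U /= subrr abs0.
  (* With [eps] below the finitely many radii, the ultrametric inequality keeps the closed
     [eps]-ball around any point of [U i] inside [U i]. *)
  have [eps [eps0 Heps]] : exists eps, (0 < eps)%Re /\
      forall i, List.In i l -> (eps < (sval i).2)%Re.
    elim: {Hl} l => [|i l [eps [eps0 IH]]]; first by exists 1%Re; split=> //; lra.
    have [i0 _] := svalP i.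
    exists (Rmin eps ((sval i).2 / 2)); split; first by apply: Rmin_pos; lra.
    move=> j [<-|/IH h]; first by have := Rmin_r eps ((sval i).2 / 2); lra.
    by have := Rmin_l eps ((sval i).2 / 2); lra.
  exists eps; split=> //.
  (* The admissible centres are the points of [S] in those selected balls on which M vanishes off
     the centre; the centres of the selected balls are the exceptional points. *)
  exists (fun a => S a /\ exists2 i, List.In i l & U i a /\
     forall x, x <> (sval i).1 -> U i x -> vanishes_at A x), [seq (sval i).1 | i <- l].
  split=> [a []//|c Sc cl].
  have ne i : List.In i l -> c <> (sval i).1.
    by move=> il e'; apply: cl; rewrite e'; exact: (List.in_map (fun i => (sval i).1)).
  split=> [van|[a [[Sa [i il [Ua H]]] ca]]].
    have [i il Uc] := Hl c Sc; exists c; split; last by rewrite subrr abs0; lra.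
    split=> //; exists i => //; split=> //.
    have [_ [//|H]] := svalP i.
    by case: (H c (ne i il) Uc).
  apply: H; first exact: ne.
  rewrite /U -(subrKA a); apply: abs_add_lt => //.
  exact: Rle_lt_trans ca (Heps i il).
- apply: periodic_progressions => //; apply: (locally_periodic_global p_prime (V := V)) => c.
  have [eta [eta0 H]] := vanishing_dichotomy gen c; exists eta; split=> //.
  by case: H => H; [left|right] => m; apply: H.
Qed.
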